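(* Let $1\le p<n$, let $F_1,\ldots,F_p\in\mathbb{Q}[X_1,\ldots,X_n]$ be a reduced regular sequence generating the ideal of definition of the affine variety $S=\{F_1=\cdots=F_p=0\}\subset\mathbb{C}^n$. Let $1\le i\le n-p$ with $2i+2>n-p$. Then for generic $a\in\mathbb{C}^{(n-p)\times n}$, i.e. for all $a$ in a suitable non-empty Zariski open subset of $\mathbb{C}^{(n-p)\times n}$ consisting of full-rank matrices, the polar varieties $W_{\underline{K}(\underline{a}^{(i)})}(S)$ and $W_{\overline{K}(\overline{a}^{(i)})}(S)$ are smooth at each of their points where $J(F_1,\ldots,F_p)$ has maximal rank $p$.
   Context: $J(F_1,\ldots,F_p)=[\partial F_k/\partial X_l]$ is the $p\times n$ Jacobian matrix. ''Reduced regular sequence'' means a regular sequence such that the ideals $(F_1,\ldots,F_k)$, $1\le k\le p$, are radical; $S$ is then non-empty of pure codimension $p$ in $\mathbb{C}^n$. $S_{reg}$ is the set of points of $S$ where $J(F_1,\ldots,F_p)$ has rank $p$. For a full-rank matrix $a\in\mathbb{C}^{(n-p)\times n}$ and $1\le i\le n-p$, $a^{(i)}$ denotes the matrix of the first $n-p-i+1$ rows of $a=[a_{k,l}]$. - The $i$th classic polar variety $W_{\underline{K}(\underline{a}^{(i)})}(S)$ is the Zariski closure of the set of points of $S_{reg}$ at which all $(n-i+1)$-minors of $\begin{bmatrix}J(F_1,\ldots,F_p)\\ a^{(i)}\end{bmatrix}$ vanish. - The $i$th dual polar variety $W_{\overline{K}(\overline{a}^{(i)})}(S)$ is the Zariski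 closure of the set of points of $S_{reg}$ at which all $(n-i+1)$-minors of the matrix with first $p$ rows $J(F_1,\ldots,F_p)$ and remaining rows $(a_{k,1}-X_1,\ldots,a_{k,n}-X_n)$, $1\le k\le n-p-i+1$, vanish. Varieties are taken set-theoretically (reduced). *)

(* Defs.v *)
From mathcomp Require Import all_boot all_order all_algebra.
From mathcomp Require Import mpoly.
From mathcomp Require Import classical_sets reals.
From mathcomp Require Import complex.

Set Implicit Arguments.
Unset Strict Implicit.
Unset Printing Implicit Defensive.

Import GRing.Theory.

Local Open Scope ring_scope.
Local Open Scope classical_set_scope.

(* Affine varieties over a field [K]: subsets of K^n, the points of K^n being
   row vectors. *)

Definition zeros (K : fieldType) (n : nat) (E : set {mpoly K[n]}) :
    set 'rV[K]_n :=
  [set x | forall f, E f -> f.@[x 0] = 0].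

Definition vanishing_ideal (K : fieldType) (n : nat) (A : set 'rV[K]_n) :
    set {mpoly K[n]} :=
  [set f | forall x, A x -> f.@[x 0] = 0].

Definition zariski_closed (K : fieldType) (n : nat) (A : set 'rV[K]_n) : Prop :=
  exists E : set {mpoly K[n]}, A = zeros E.

Definition zariski_closure (K : fieldType) (n : nat) (A : set 'rV[K]_n) :
    set 'rV[K]_n :=
  zeros (vanishing_ideal A).

(* The affine space K^(m x n) is identified with K^(m * n) through [mxvec]. *)
Definition zariski_open_mx (K : fieldType) (m n : nat)
    (U : set 'M[K]_(m, n)) : Prop :=
  exists2 A : set 'rV[K]_(m * n),
    zariski_closed A & U = [set a | ~ A (mxvec a)].

Definition irreducible_closed (K : fieldType) (n : nat)
    (Z : set 'rV[K]_n) : Prop :=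
  [/\ zariski_closed Z, Z !=set0 &
      forall A B : set 'rV[K]_n, zariski_closed A -> zariski_closed B ->
        Z `<=` A `|` B -> Z `<=` A \/ Z `<=` B].

(* The coordinate ring K[X]/I(Z) contains [d] elements algebraically
   independent over K. *)
Definition has_alg_indep (K : fieldType) (n : nat) (Z : set 'rV[K]_n)
    (d : nat) : Prop :=
  exists g : d.-tuple {mpoly K[n]},
    forall P : {mpoly K[d]}, vanishing_ideal Z (P \mPo g) -> P = 0.

(* For irreducible [Z], the transcendence degree over K of the function field
   of [Z], that is, of the fraction field of K[X]/I(Z). *)
Definition has_dim (K : fieldType) (n : nat) (Z : set 'rV[K]_n)
    (d : nat) : Prop :=
  has_alg_indep Z d /\ forall e, has_alg_indep Z e -> (e <= d)%N.

(* The largest dimension of an irreducible closed subset of [W] through [x];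
   it is reached at an irreducible component of [W]. *)
Definition has_local_dim (K : fieldType) (n : nat) (W : set 'rV[K]_n)
    (x : 'rV[K]_n) (d : nat) : Prop :=
  (exists Z, [/\ irreducible_closed Z, Z `<=` W, Z x & has_dim Z d]) /\
  (forall Z e, irreducible_closed Z -> Z `<=` W -> Z x -> has_dim Z e ->
     (e <= d)%N).

Definition tangent_space (K : fieldType) (n : nat) (W : set 'rV[K]_n)
    (x : 'rV[K]_n) : set 'rV[K]_n :=
  [set v | forall f, vanishing_ideal W f ->
     \sum_(l < n) (f^`M(l)).@[x 0] * v 0 l = 0].

Definition smooth_at (K : fieldType) (n : nat) (W : set 'rV[K]_n)
    (x : 'rV[K]_n) : Prop :=
  W x /\ exists T : {vspace 'rV[K]_n},
    (forall v, v \in T <-> tangent_space W x v) /\ has_local_dim W x (\dim T).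

(* The ideal generated by the first [k] members of [F]. *)
Definition ideal_first (K : fieldType) (n p : nat) (F : 'I_p -> {mpoly K[n]})
    (k : nat) : set {mpoly K[n]} :=
  [set f | exists c : 'I_p -> {mpoly K[n]},
     f = \sum_(j < p | (j < k)%N) c j * F j].

Definition regular_sequence (K : fieldType) (n p : nat)
    (F : 'I_p -> {mpoly K[n]}) : Prop :=
  ~ ideal_first F p 1 /\
  forall (k : 'I_p) (g : {mpoly K[n]}),
    ideal_first F k (g * F k) -> ideal_first F k g.

Definition radical_ideal (K : fieldType) (n : nat) (I : set {mpoly K[n]}) :
    Prop :=
  forall (f : {mpoly K[n]}) (m : nat), I (f ^+ m) -> I f.

Definition reduced_regular_sequence (K : fieldType) (n p : nat)
    (F : 'I_p -> {mpoly K[n]}) : Prop :=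
  regular_sequence F /\
  forall k : nat, (1 <= k <= p)%N -> radical_ideal (ideal_first F k).

Definition jacobian (K : fieldType) (n p : nat) (F : 'I_p -> {mpoly K[n]})
    (x : 'rV[K]_n) : 'M[K]_(p, n) :=
  \matrix_(k < p, l < n) ((F k)^`M(l)).@[x 0].

Definition variety (K : fieldType) (n p : nat) (F : 'I_p -> {mpoly K[n]}) :
    set 'rV[K]_n :=
  [set x | forall k, (F k).@[x 0] = 0].

Definition regular_points (K : fieldType) (n p : nat)
    (F : 'I_p -> {mpoly K[n]}) : set 'rV[K]_n :=
  [set x | variety F x /\ \rank (jacobian F x) = p].

(* Row and column selections are arbitrary functions: a repeated index gives
   determinant 0, and a reordering only changes the sign. *)
Definition minors_vanish (K : fieldType) (m n : nat) (k : nat)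
    (M : 'M[K]_(m, n)) : Prop :=
  forall (r : 'I_k -> 'I_m) (c : 'I_k -> 'I_n), \det (mxsub r c M) = 0.

(* [minn] only serves to make the definition total; [minn k m] is [k] when
   [k <= m]. *)
Definition first_rows (K : fieldType) (m n : nat) (k : nat)
    (a : 'M[K]_(m, n)) : 'M[K]_(minn k m, n) :=
  rowsub (widen_ord (geq_minr k m)) a.

(* The first n - p - i + 1 rows of [a]. *)
Definition polar_rows (K : fieldType) (n p : nat) (a : 'M[K]_(n - p, n))
    (i : nat) : 'M[K]_(minn (n - p - i).+1 (n - p), n) :=
  first_rows (n - p - i).+1 a.

Definition classic_polar (K : fieldType) (n p : nat)
    (F : 'I_p -> {mpoly K[n]}) (a : 'M[K]_(n - p, n)) (i : nat) :
    set 'rV[K]_n :=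
  zariski_closure
    [set x | regular_points F x /\
       minors_vanish (n - i).+1 (col_mx (jacobian F x) (polar_rows a i))].

Definition dual_polar (K : fieldType) (n p : nat)
    (F : 'I_p -> {mpoly K[n]}) (a : 'M[K]_(n - p, n)) (i : nat) :
    set 'rV[K]_n :=
  zariski_closure
    [set x | regular_points F x /\
       minors_vanish (n - i).+1
         (col_mx (jacobian F x)
            (\matrix_(k, l) (polar_rows a i k l - x 0 l)))].

Definition complexify (R : realType) (n p : nat) (F : 'I_p -> {mpoly rat[n]}) :
    'I_p -> {mpoly R[i][n]} :=
  fun k => map_mpoly ratr (F k).

(* Main.v *)
(* Both families are cut out on the regular points of S by a rank condition on
   M = [J(F)(x); a - e x], with e = 0 or 1.

   Genericity. If a property fails for a Zariski dense set of matrices a, an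
   ultraproduct gives a field L containing K, a matrix a over L with entries
   algebraically independent over K, and a point x over L violating it. Every
   direction c then extends to a derivation of L over K with da = c.
   Differentiating U M N = 0, where U and N span kernels of M, shows that
   dx |-> U (dM)(dx) N maps the kernel of J(F)(x) onto all matrices, so the
   property "this map is onto" holds for generic a. Counting dimensions, the
   rank of M cannot drop by two since 2i + 2 > n - p, and where it drops by one
   the entries of a Schur complement of M are local equations of the polar
   variety, with differentials independent modulo those of F.

   Smoothness. Near such a point x the polar variety is the zero set of r
   equations with independent differentials. Newton iteration yields a formal
   solution with n - r free parameters; the polynomials vanishing on it form a
   prime ideal, and by the Nullstellensatz its zero set is an irreducible
   subvariety through x carrying n - r algebraically independent functions.
   Conversely, derivations at a generic point bound the dimension of every
   irreducible subvariety through x by n - r. *)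

Require Import Defs.
From HB Require Import structures.
From mathcomp Require Import all_boot all_order all_algebra.
From mathcomp Require Import generic_quotient ring_quotient fraction.
From mathcomp Require Import mpoly.
From mathcomp Require Import boolp classical_sets functions filter reals.
From mathcomp Require Import complex.
From mathcomp Require Import ring zify.
Set Implicit Arguments.
Unset Strict Implicit.
Unset Printing Implicit Defensive.
Import GRing.Theory.
Local Open Scope ring_scope.
Local Open Scope classical_set_scope.

(** * Residue fields of prime ideals *)

Section PrimeQuotient.
Variables (A : comNzRingType) (I : prime_idealr A).

Definition prime_quot := {ideal_quot I}.

HB.instance Definition _ := GRing.ComNzRing.on prime_quot.

(** Units and inverses are chosen classically: forming fractions requires an integral domain with a
    unit structure. *)
Definition prime_quot_unit (x : prime_quot) : bool :=
  `[< exists y, y * x = 1 >].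

Definition prime_quot_inv (x : prime_quot) : prime_quot :=
  if pselect (exists y, y * x = 1) is left e then projT1 (cid e) else x.

Lemma prime_quot_mulV :
  {in prime_quot_unit, left_inverse 1 prime_quot_inv *%R}.
Proof.
move=> x /asboolP hx; rewrite /prime_quot_inv; case: pselect => // e.
by case: (cid e).
Qed.

Lemma prime_quot_unitP (x y : prime_quot) : y * x = 1 -> prime_quot_unit x.
Proof. by move=> h; apply/asboolP; exists y. Qed.

Lemma prime_quot_inv_out : {in [predC prime_quot_unit], prime_quot_inv =1 id}.
Proof.
by move=> x /asboolPn hx; rewrite /prime_quot_inv; case: pselect.
Qed.

HB.instance Definition _ := GRing.ComNzRing_hasMulInverse.Build prime_quot
  prime_quot_mulV prime_quot_unitP prime_quot_inv_out.
HB.instance Definition _ := GRing.ComUnitRing_isIntegral.Build prime_quot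
  (@Quotient.rquot_IdomainAxiom A I).

End PrimeQuotient.

Lemma fractionE (D : idomainType) (y : {fraction D}) :
  exists u v : D, v != 0 /\ y = FracField.tofrac u / FracField.tofrac v.
Proof.
elim/quotW: y => y; exists (frac y).1, (frac y).2; split.
  exact: denom_ratioP.
apply: (canRL (mulfK _)); first by rewrite tofrac_eq0 denom_ratioP.
rewrite -[LHS]/(FracField.mul _ _) !piE; apply/eqmodP.
have dy := denom_ratioP y.
rewrite /= FracField.equivfE /FracField.mulf !numden_Ratio ?mulr1 ?oner_neq0 //.
by rewrite mulrC.
Qed.

Section PrimeQuotientField.
Local Open Scope quotient_scope.
Variables (A : comNzRingType) (P : A -> Prop).
Hypotheses (P0 : P 0) (PB : forall u v, P u -> P v -> P (u - v)).
Hypotheses (PM : forall u v, P v -> P (u * v)) (P1 : ~ P 1).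
Hypothesis (P_prime : forall u v, P (u * v) -> P u \/ P v).

Let I (u : A) : bool := `[< P u >].

Let I_closed : idealr_closed I.
Proof.
split; first by apply/asboolP.
  by apply/asboolPn.
move=> a u v /asboolP Pu /asboolP Pv; apply/asboolP.
rewrite -[v]opprK; apply: PB; first exact: PM.
by rewrite -[- v]sub0r; apply: PB.
Qed.

Let I_prime : prime_idealr_closed I.
Proof.
move=> u v /asboolP /P_prime [] /asboolP h; apply/orP; [left|right]; exact: h.
Qed.

Let J : prime_idealr A := HB.pack_for (prime_idealr A) I
  (isIdealr.Build A I I_closed) (isPrimeIdealrClosed.Build A I I_prime).

(** The fraction field of A/P. It will serve for vanishing ideals, for ideals of formal solutions
    and for ultrafilters on rings of functions. *)
Lemma prime_quotient_field : exists (L : fieldType) (psi : {rmorphism A -> L}),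
  (forall u, psi u = 0 <-> P u) /\
  forall y, exists u v, psi v != 0 /\ y = psi u / psi v.
Proof.
pose Q : idomainType := prime_quot J.
pose pi : {rmorphism A -> {ideal_quot J}} := \pi_{ideal_quot J}.
have proj_eq0 (u : A) : (pi u == 0) = I u.
  by rewrite -(rmorph0 pi) -Quotient.idealrBE subr0.
exists {fraction Q}.
exists ((@FracField.tofrac Q : {rmorphism Q -> {fraction Q}}) \o
        (pi : {rmorphism A -> Q})).
split=> [u|y] /=.
  split=> [/eqP|Pu]; first by rewrite tofrac_eq0 proj_eq0 => /asboolP.
  by apply/eqP; rewrite tofrac_eq0 proj_eq0; apply/asboolP.
have [u [v [v0 ->]]] := fractionE y.
exists (repr (u : {ideal_quot J})), (repr (v : {ideal_quot J})).
by rewrite /pi !reprK tofrac_eq0.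
Qed.

End PrimeQuotientField.

(** * Partial homomorphisms defined on subrings of a field *)

Section SubringSet.
Variable R : comNzRingType.
Implicit Types (G : set R) (p q : {poly R}).

Definition subring_set G : Prop :=
  [/\ G 1, forall u v, G u -> G v -> G (u - v) &
      forall u v, G u -> G v -> G (u * v)].

Definition poly_over G : set {poly R} := [set p | forall i, G p`_i].

Definition adjoin G (x : R) : set R := [set p.[x] | p in poly_over G].

Variable G : set R.
Hypothesis sG : subring_set G.

Lemma subring_set0 : G 0.
Proof. by case: sG => G1 GB _; rewrite -(subrr 1); apply: GB. Qed.

Lemma subring_setD u v : G u -> G v -> G (u + v).
Proof.
case: sG => _ GB _ Gu Gv; rewrite -[v]opprK; apply: (GB) => //.
by rewrite -[- v]sub0r; apply: GB => //; exact: subring_set0.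
Qed.

Lemma subring_set_sum (I : Type) (r : seq I) (Q : pred I) (F : I -> R) :
  (forall i, Q i -> G (F i)) -> G (\sum_(i <- r | Q i) F i).
Proof. by apply: (big_ind G); [exact: subring_set0 | exact: subring_setD]. Qed.

Lemma subring_setX u k : G u -> G (u ^+ k).
Proof.
case: sG => G1 _ GM Gu; elim: k => [|k IH]; first by rewrite expr0.
by rewrite exprS; apply: GM.
Qed.

Lemma poly_overB p q : poly_over G p -> poly_over G q -> poly_over G (p - q).
Proof. by case: sG => _ GB _ hp hq i; rewrite coefB; apply: GB. Qed.

Lemma poly_overM p q : poly_over G p -> poly_over G q -> poly_over G (p * q).
Proof.
case: sG => _ _ GM hp hq i; rewrite coefM; apply: subring_set_sum => j _.
exact: GM.
Qed.

Lemma poly_overC c : G c -> poly_over G c%:P.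
Proof. by move=> Gc i; rewrite coefC; case: ifP => // _; exact: subring_set0. Qed.

Lemma poly_overX : poly_over G 'X.
Proof.
move=> i; rewrite coefX; case: (i == 1%N); last exact: subring_set0.
by case: sG.
Qed.

Lemma poly_overXn k : poly_over G 'X^k.
Proof.
elim: k => [|k IH]; first by rewrite expr0; apply: poly_overC; case: sG.
by rewrite exprS; apply: poly_overM => //; exact: poly_overX.
Qed.

Lemma adjoin_subring x : subring_set (adjoin G x).
Proof.
split.
- by exists 1; rewrite ?hornerC //; apply: poly_overC; case: sG.
- move=> _ _ [p hp <-] [q hq <-]; exists (p - q); last by rewrite hornerD hornerN.
  exact: poly_overB.
- move=> _ _ [p hp <-] [q hq <-]; exists (p * q); last by rewrite hornerM.
  exact: poly_overM.
Qed.

Lemma sub_adjoin x u : G u -> adjoin G x u.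
Proof. by move=> Gu; exists u%:P; rewrite ?hornerC //; exact: poly_overC. Qed.

Lemma mem_adjoin x : adjoin G x x.
Proof. by exists 'X; rewrite ?hornerX //; exact: poly_overX. Qed.

(** Pseudo-division: [lead_coef mu] need not be invertible in [G], so a power of it multiplies [p];
    each step cancels the leading term of [p]. *)
Lemma poly_over_pdiv (mu : {poly R}) : poly_over G mu -> mu != 0 ->
  forall p, poly_over G p -> exists k q r,
    [/\ poly_over G q, poly_over G r, (size r < size mu)%N &
        (lead_coef mu ^+ k) *: p = q * mu + r].
Proof.
move=> hmu mu0 p; have [m] := ubnP (size p); elim: m => // m IH in p *.
rewrite ltnS => pm hp; have [lt_p|le_p] := ltnP (size p) (size mu).
  exists 0%N, 0, p; split; rewrite ?expr0 ?scale1r ?mul0r ?add0r //.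
  by rewrite -polyC0; apply: poly_overC; exact: subring_set0.
have [p0|p0] := eqVneq p 0.
  by move: le_p; rewrite p0 size_poly0 leqn0 size_poly_eq0 (negPf mu0).
pose a := (lead_coef p)%:P * 'X^(size p - size mu).
have ha : poly_over G a.
  by apply: poly_overM; [apply: poly_overC; exact: hp | exact: poly_overXn].
pose p' := lead_coef mu *: p - a * mu.
have hp' : poly_over G p'.
  apply: poly_overB; last exact: poly_overM.
  by rewrite -mul_polyC; apply: poly_overM => //; apply: poly_overC; exact: hmu.
have sp' : (size p' < size p)%N.
  have sp0 : (0 < size p)%N by rewrite size_poly_gt0.
  rewrite -[X in (_ < X)%N](prednK sp0) ltnS; apply/leq_sizeP => j.
  rewrite leq_eqVlt => /orP[/eqP <-|lj].
    rewrite /p' coefB coefZ /a -mulrA coefCM coefXnM.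
    have -> : ((size p).-1 < size p - size mu)%N = false.
      by move: le_p sp0; rewrite -size_poly_gt0 in mu0; lia.
    have -> : ((size p).-1 - (size p - size mu) = (size mu).-1)%N.
      by rewrite -size_poly_gt0 in mu0; lia.
    by rewrite -/(lead_coef _) mulrC subrr.
  rewrite /p' coefB coefZ /a -mulrA coefCM coefXnM.
  rewrite prednK // in lj; rewrite [p`_j]nth_default //.
  case: ltnP => _; first by rewrite !mulr0 subr0.
  rewrite [X in _ - _ * X]nth_default ?mulr0 ?subr0 //.
  by rewrite -{1}(subKn le_p) leq_sub2r.
have [k [q [r [hq hr sr e]]]] := IH p' (leq_trans sp' pm) hp'.
exists k.+1, (q + (lead_coef mu ^+ k)%:P * a), r; split=> //.
  rewrite -[X in q + X]opprK; apply: poly_overB => //.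
  rewrite -[- _]sub0r; apply: poly_overB.
    by apply: poly_overC; exact: subring_set0.
  by apply: poly_overM => //; apply: poly_overC; apply: subring_setX; apply: hmu.
rewrite mulrDl -addrA (addrC _ r) addrA -e /p' scalerBr -mul_polyC.
by rewrite mul_polyC scalerA -exprSr -mulrA mul_polyC subrK.
Qed.

End SubringSet.

(** * Minimal polynomials over a subring *)

Section MinPoly.
Variables (L : fieldType) (K : set L).
Hypothesis sK : subring_set K.

Lemma minpoly_dichotomy (x : L) :
  (forall p, poly_over K p -> p.[x] = 0 -> p = 0) \/
  exists mu, [/\ poly_over K mu, mu != 0, mu.[x] = 0 &
    forall p, poly_over K p -> (size p < size mu)%N -> p.[x] = 0 -> p = 0].
Proof.
have [h|h] := pselect (exists m, exists mu,
    [/\ poly_over K mu, mu != 0, mu.[x] = 0 & size mu = m]); last first.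
  left=> p hp px; apply/eqP/negP => /negP p0; apply: h.
  by exists (size p), p.
right; have {}h : exists m, `[< exists mu,
    [/\ poly_over K mu, mu != 0, mu.[x] = 0 & size mu = m] >].
  by case: h => m hm; exists m; apply/asboolP.
case: (ex_minnP h) => m /asboolP [mu [hmu mu0 mux sm]] min.
exists mu; split=> // p hp; rewrite sm => lt_p px; apply/eqP/negP => /negP p0.
move: lt_p; rewrite ltnNge => /negP; apply; apply: min; apply/asboolP.
by exists p.
Qed.

Variables (x : L) (mu : {poly L}).
Hypotheses (hmu : poly_over K mu) (mu0 : mu != 0) (mux : mu.[x] = 0).
Hypothesis mu_min :
  forall p, poly_over K p -> (size p < size mu)%N -> p.[x] = 0 -> p = 0.

Lemma size_minpoly : (1 < size mu)%N.
Proof.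
rewrite ltnNge; apply/negP => /size1_polyC mc; move: mux mu0.
by rewrite mc hornerC => ->; rewrite polyC0 eqxx.
Qed.

(** Take a non-zero multiple h(x) of f(x) with [h] of least size. Pseudo-dividing [mu] by [h] leaves
    a remainder whose value at x is again a multiple of f(x), hence zero; the minimality of [mu]
    then forces [h] to be constant. *)
Lemma adjoin_inv_mod f : poly_over K f -> f.[x] != 0 ->
  exists a c, [/\ poly_over K a, K c, c != 0 & a.[x] * f.[x] = c].
Proof.
have [K1 _ KM] := sK.
move=> hf fx; pose S m := exists h a,
  [/\ poly_over K h, poly_over K a, h.[x] != 0, h.[x] = a.[x] * f.[x] & size h = m].
have S_ex : exists m, `[< S m >].
  exists (size f); apply/asboolP; exists f, 1; split=> //; last by rewrite hornerC mul1r.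
  exact: poly_overC.
case: (ex_minnP S_ex) => m /asboolP [h [a [hh ha hx e sm]]] min.
have lead_K p : poly_over K p -> K (lead_coef p) by move=> hp; exact: hp.
have lead0 (p : {poly L}) : p != 0 -> forall k, lead_coef p ^+ k != 0.
  by move=> p0 k; rewrite expf_eq0 lead_coef_eq0 (negPf p0) andbF.
have min' h' : poly_over K h' ->
    (exists2 a', poly_over K a' & h'.[x] = a'.[x] * f.[x]) ->
    h'.[x] != 0 -> (m <= size h')%N.
  by move=> hh' [a' ha' e'] h'x; apply: min; apply/asboolP; exists h', a'.
have h0 : h != 0 by apply: contraNneq hx => ->; rewrite horner0.
have lt_h : (size h < size mu)%N.
  have [k [q [r [hq hr sr er]]]] := poly_over_pdiv sK hmu mu0 hh.
  have rx : r.[x] = lead_coef mu ^+ k * h.[x].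
    by rewrite -hornerZ er hornerD hornerM mux mulr0 add0r.
  apply: leq_ltn_trans sr; rewrite sm; apply: min' => //.
    exists ((lead_coef mu ^+ k)%:P * a); last by rewrite hornerM hornerC -mulrA -e.
    apply: poly_overM => //; apply: poly_overC => //.
    by apply: subring_setX => //; exact: lead_K.
  by rewrite rx mulf_neq0 ?lead0.
have [k [q [r [hq hr sr er]]]] := poly_over_pdiv sK hh h0 hmu.
have rx : r.[x] = - q.[x] * h.[x].
  apply/eqP; rewrite mulNr -addr_eq0 addrC -hornerM -hornerD -er hornerZ mux.
  by rewrite mulr0.
have rx0 : r.[x] = 0.
  apply/eqP/negP => /negP rx0; move: sr; rewrite sm ltnNge => /negP; apply.
  apply: min' => //; exists ((0 - q) * a).
    apply: poly_overM => //; apply: poly_overB => //.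
    by rewrite -polyC0; apply: poly_overC => //; exact: subring_set0.
  by rewrite hornerM sub0r hornerN rx e mulrA.
have qx : q.[x] = 0.
  move/eqP: rx; rewrite rx0 eq_sym mulf_eq0 (negPf hx) orbF oppr_eq0.
  by move/eqP.
have r0 : r = 0 by apply: mu_min => //; apply: ltn_trans lt_h.
have [sh|sh] := leqP (size h) 1.
  have hc := size1_polyC sh; exists a, h`_0; split=> //.
    by apply: contraNneq h0 => h0'; rewrite hc h0'.
  by rewrite -e {1}hc hornerC.
exfalso; have q0 : q != 0.
  apply: contraTneq mu0 => q0; move/eqP: er; rewrite q0 r0 mul0r addr0.
  by rewrite scaler_eq0 (negPf (lead0 _ h0 k)) /= => ->.
have sq : size (lead_coef h ^+ k *: mu) = size (q * h) by rewrite er r0 addr0.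
move/eqP: (q0); apply; apply: mu_min => //.
rewrite -(size_scale mu (lead0 _ h0 k)) sq.
rewrite size_mul //; case: (size h) sh => [|[|m']] // _.
by rewrite !addnS /= ltnS leq_addr.
Qed.

End MinPoly.

Section PartialHom.
Variables (L : fieldType) (E : comNzRingType).
Implicit Types (G : set (L * E)%type) (P : {poly (L * E)%type}).

(** The graph of a ring homomorphism from a subring of [L] to [E]; the second condition makes it
    single-valued. *)
Definition partial_hom G : Prop :=
  subring_set G /\ forall w, G (0, w) -> w = 0.

Definition phom_dom G : set L := [set u | exists w, G (u, w)].

Lemma phom_dom_subring G : subring_set G -> subring_set (phom_dom G).
Proof.
case=> G1 GB GM; split; first by exists 1.
- by move=> u v [u' Gu] [v' Gv]; exists (u' - v'); apply: (GB _ _ Gu Gv).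
- by move=> u v [u' Gu] [v' Gv]; exists (u' * v'); apply: (GM _ _ Gu Gv).
Qed.

Lemma horner_pair P (z : (L * E)%type) :
  P.[z] = ((map_poly fst P).[z.1], (map_poly snd P).[z.2]).
Proof. by rewrite !horner_map; case: P.[z]. Qed.

Lemma phom_lift G (p : {poly L}) : partial_hom G ->
  poly_over (phom_dom G) p ->
  exists P, [/\ poly_over G P, map_poly fst P = p & size P = size p].
Proof.
move=> [sG Ginj] hp; have [f hf] := choice hp.
have f0 i : (size p <= i)%N -> f i = 0.
  by move=> hi; apply: Ginj; rewrite -(nth_default 0 hi); exact: hf.
have coefP i : (\poly_(i < size p) (p`_i, f i))`_i = (p`_i, f i).
  rewrite coef_poly; case: ltnP => // hi.
  by rewrite nth_default // f0.
exists (\poly_(i < size p) (p`_i, f i)); split.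
- by move=> i; rewrite coefP.
- by apply/polyP => i; rewrite coef_map coefP.
- apply/eqP; rewrite eqn_leq size_poly /=; apply/leq_sizeP => i hi.
  have := coefP i; rewrite [LHS]nth_default // => -[<-] //.
Qed.

Lemma poly_over_dom G P :
  poly_over G P -> poly_over (phom_dom G) (map_poly fst P).
Proof.
move=> hP i; rewrite coef_map /=; have := hP i.
by case: P`_i => u w; exists w.
Qed.

Lemma poly_over_fst_eq0 G P : partial_hom G -> poly_over G P ->
  map_poly fst P = 0 -> P = 0.
Proof.
move=> [sG Ginj] hP /polyP P0; apply/polyP => i; move: (P0 i) (hP i).
rewrite coef_map !coef0 /=; case: P`_i => u w /= -> h.
by rewrite (Ginj _ h).
Qed.

Lemma phom_fun G u w w' : partial_hom G -> G (u, w) -> G (u, w') -> w = w'.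
Proof.
move=> [[_ GB _] Ginj] h h'; have := GB _ _ h h'.
by rewrite -[X in G X]/(u - u, w - w') subrr => /Ginj /eqP; rewrite subr_eq0 => /eqP.
Qed.

Lemma phom_dom_adjoin G x e : partial_hom G ->
  phom_dom (adjoin G (x, e)) = adjoin (phom_dom G) x.
Proof.
move=> hG; apply/seteqP; split=> [u [w [P hP]]|_ [p hp <-]].
  rewrite horner_pair => -[<- _]; exists (map_poly fst P) => //.
  exact: poly_over_dom.
have [P [hP Pp _]] := phom_lift hG hp.
exists (map_poly snd P).[e]; exists P => //.
by rewrite horner_pair /= Pp.
Qed.

(** No relation constrains the image of a transcendental element, so [e] is arbitrary. *)
Lemma phom_adjoin_transc G (x : L) (e : E) : partial_hom G ->
  (forall p, poly_over (phom_dom G) p -> p.[x] = 0 -> p = 0) ->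
  partial_hom (adjoin G (x, e)).
Proof.
move=> hG tr; split; first by apply: adjoin_subring; case: hG.
move=> w [P hP]; rewrite horner_pair => -[P1 <-].
have /(poly_over_fst_eq0 hG hP) -> := tr _ (poly_over_dom hP) P1.
by rewrite rmorph0 horner0.
Qed.

(** If a polynomial [Q] over the graph vanishes at x, its pseudo-remainder modulo [P] is zero by
    minimality. A power of the image of the leading coefficient thus kills the image of Q(x), and
    the last hypothesis cancels that power. *)
Lemma phom_adjoin_alg G (x : L) (e : E) (mu : {poly L}) P : partial_hom G ->
  mu != 0 -> mu.[x] = 0 ->
  (forall p, poly_over (phom_dom G) p -> (size p < size mu)%N ->
    p.[x] = 0 -> p = 0) ->
  poly_over G P -> map_poly fst P = mu -> size P = size mu ->
  (map_poly snd P).[e] = 0 ->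
  (forall w, (lead_coef P).2 * w = 0 -> w = 0) ->
  partial_hom (adjoin G (x, e)).
Proof.
move=> hG mu0 mux min hP Pmu sP Pe reg.
split; first by apply: adjoin_subring; case: hG.
move=> w [Q hQ eQ].
have P0 : P != 0 by rewrite -size_poly_eq0 sP size_poly_eq0.
have [k [q [r [hq hr sr er]]]] := poly_over_pdiv (proj1 hG) hP P0 hQ.
have Pxe : P.[(x, e)] = 0 by rewrite horner_pair /= Pmu mux Pe.
have erx : (lead_coef P ^+ k) * (0, w) = r.[(x, e)].
  by rewrite -eQ -hornerZ er hornerD hornerM Pxe mulr0 add0r.
have r0 : r = 0.
  apply: (poly_over_fst_eq0 hG hr); apply: min.
  - exact: poly_over_dom.
  - by rewrite -sP; apply: leq_ltn_trans sr; exact: size_poly.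
  - by move: erx; rewrite horner_pair => /(congr1 fst) /= <-; rewrite mulr0.
move: erx; rewrite r0 horner0 => /(congr1 snd) /=.
elim: k {er} => [|k IH]; first by rewrite expr0 mul1r.
by rewrite exprS -mulrA => /reg.
Qed.

End PartialHom.

(** * Extension of derivations *)

Section DualNumbers.
Variable L : fieldType.

(** A copy of [L * L], whose own product is componentwise, to carry the product with eps^2 = 0. A
    map D is a derivation exactly when u |-> u + D(u) eps is a ring homomorphism. *)
Definition dual := (L * L)%type.

HB.instance Definition _ := GRing.Zmodule.on dual.

Definition dual_one : dual := (1, 0).
Definition dual_mul (u v : dual) : dual := (u.1 * v.1, u.1 * v.2 + u.2 * v.1).

Fact dual_mulA : associative dual_mul.
Proof. by move=> [a b] [c d] [e f]; congr pair => /=; ring. Qed.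
Fact dual_mulC : commutative dual_mul.
Proof. by move=> [a b] [c d]; congr pair => /=; ring. Qed.
Fact dual_mul1 : left_id dual_one dual_mul.
Proof. by move=> [a b]; congr pair => /=; ring. Qed.
Fact dual_mulDl : left_distributive dual_mul +%R.
Proof. by move=> [a b] [c d] [e f]; congr pair => /=; ring. Qed.
Fact dual_one_neq0 : dual_one != 0.
Proof. by apply/eqP => -[] /eqP; rewrite oner_eq0. Qed.

HB.instance Definition _ := GRing.Zmodule_isComNzRing.Build dual
  dual_mulA dual_mulC dual_mul1 dual_mulDl dual_one_neq0.

Definition dual_re (u : dual) : L := u.1.

Fact dual_re_zmod : zmod_morphism dual_re. Proof. by []. Qed.
Fact dual_re_monoid : monoid_morphism dual_re. Proof. by []. Qed.
HB.instance Definition _ := GRing.isZmodMorphism.Build dual L dual_re dual_re_zmod.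
HB.instance Definition _ :=
  GRing.isMonoidMorphism.Build dual L dual_re dual_re_monoid.

(** The value at x + w eps is affine in [w], and its slope is the derivative at x of the real part
    of [Q]. *)
Lemma horner_dual (Q : {poly dual}) (x : L) : exists r, forall w,
  Q.[(x, w) : dual] =
    ((map_poly dual_re Q).[x], r + (map_poly dual_re Q)^`().[x] * w).
Proof.
elim/poly_ind: Q => [|p c [r IH]].
  by exists 0 => w; rewrite rmorph0 deriv0 !horner0 mul0r addr0.
exists (r * x + c.2) => w.
rewrite hornerMXaddC IH rmorphD rmorphM /= map_polyX map_polyC /=.
rewrite derivD derivC derivM derivX addr0 mulr1 !hornerE.
rewrite -[LHS]/(_, _); congr pair.
set a := _.[x]; set b := _^`().[x]; rewrite -[X in X = _]/(a * w + (r + b * w) * x + c.2).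
by ring.
Qed.

End DualNumbers.

Section PointDerivation.
Variables (C : comNzRingType) (n : nat) (S : comNzRingType).
Variables (ev : {rmorphism {mpoly C[n]} -> S}) (v : 'I_n -> S).

Definition point_der (f : {mpoly C[n]}) : S := \sum_l ev (f^`M(l)) * v l.

Lemma point_derB f g : point_der (f - g) = point_der f - point_der g.
Proof.
by rewrite -sumrB; apply: eq_bigr => l _; rewrite mderivB rmorphB mulrBl.
Qed.

Lemma point_derD f g : point_der (f + g) = point_der f + point_der g.
Proof.
rewrite -big_split; apply: eq_bigr => l _.
by rewrite mderivD rmorphD mulrDl.
Qed.

Lemma point_derM f g : point_der (f * g) = ev f * point_der g + point_der f * ev g.
Proof.
rewrite /point_der mulr_sumr mulr_suml -big_split /=; apply: eq_bigr => l _.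
by rewrite mderivM rmorphD !rmorphM; ring.
Qed.

Lemma point_derC c : point_der c%:MP = 0.
Proof. by rewrite /point_der big1 // => l _; rewrite mderivC rmorph0 mul0r. Qed.

Lemma point_derX j : point_der 'X_j = v j.
Proof.
rewrite /point_der (bigD1 j) //= big1 ?addr0 => [|l /negPf lj].
  rewrite mderivX mnm1E eqxx scale1r -[X in (X - _)%MM]addm0 addmC addmK.
  by rewrite mpolyX0 rmorph1 mul1r.
rewrite mderivX mnm1E eq_sym lj scale0r rmorph0 mul0r //.
Qed.

End PointDerivation.

Section DerivationExists.
Variables (C L : fieldType) (iota : {rmorphism C -> L}).
Hypothesis char0 : forall k, k.+1%:R != 0 :> L.

(** The homomorphism is a section of [dual_re], so that its second component is a derivation. *)
Let lift_re (G : set (L * dual L)%type) :=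
  forall u e, G (u, e) -> dual_re e = u.

Let map_re (G : set (L * dual L)%type) (P : {poly (L * dual L)%type}) :
  lift_re G -> poly_over G P ->
  map_poly (@dual_re L) (map_poly snd P) = map_poly fst P.
Proof.
move=> hG hP; apply/polyP => i; rewrite !coef_map /=; have := hP i.
by case: P`_i => u e /hG.
Qed.

(** At a transcendental [x] any [w] will do; at an algebraic one, characteristic 0 makes the
    condition on [w] a linear equation with non-zero slope. *)
Lemma dual_phom_adjoin (G : set (L * dual L)%type) (x : L) :
  partial_hom G -> lift_re G ->
  exists w : L, partial_hom (adjoin G (x, (x, w) : dual L)).
Proof.
move=> hG reG; have sG := proj1 hG.
have [tr|[mu [hmu mu0 mux min]]] := minpoly_dichotomy (phom_dom G) x.
  by exists 0; exact: phom_adjoin_transc.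
have [P [hP Pmu sP]] := phom_lift hG hmu.
have smu := size_minpoly mu0 mux.
have hmu' : poly_over (phom_dom G) mu^`().
  move=> i; rewrite coef_deriv -mulr_natr.
  have [d1 dB dM] := phom_dom_subring sG.
  apply: dM => //; rewrite -[_.+1]card_ord -sumr_const.
  by apply: subring_set_sum => //; exact: phom_dom_subring.
have dmux : mu^`().[x] != 0.
  apply/eqP => d0; have /polyP/(_ (size mu).-2) := min _ hmu' (lt_size_deriv mu0) d0.
  rewrite coef_deriv coef0 -mulr_natr => /eqP.
  rewrite mulf_eq0 (negPf (char0 _)) orbF.
  have -> : (size mu).-2.+1 = (size mu).-1 by case: (size mu) smu => [|[]].
  by rewrite -/(lead_coef mu) lead_coef_eq0 (negPf mu0).
have [r hr] := horner_dual (map_poly snd P) x.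
(* This [w] is the solution of r + mu'(x) w = 0, which makes x + w eps a root of the lifted [mu]. *)
exists (- (r / mu^`().[x])); apply: (phom_adjoin_alg hG mu0 mux min hP) => //.
  rewrite hr (map_re reG hP) Pmu mux mulrN mulrCA divff // mulr1 subrr //.
have lP : dual_re (lead_coef P).2 != 0.
  have -> : dual_re (lead_coef P).2 = lead_coef mu.
    have -> : lead_coef mu = (lead_coef P).1 by rewrite /lead_coef -sP -Pmu coef_map.
    by apply: reG; rewrite -surjective_pairing; exact: hP.
  by rewrite lead_coef_eq0.
case: (lead_coef P).2 lP => a b a0 [w1 w2] [/eqP]; rewrite mulf_eq0 (negPf a0).
by move=> /= /eqP ->; rewrite mulr0 addr0 => /eqP; rewrite mulf_eq0 (negPf a0) => /eqP ->.
Qed.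

Variables (N : nat) (a c : 'I_N -> L).
Hypothesis a_indep : forall P : {mpoly C[N]}, mmap iota a P = 0 -> P = 0.

Let ev : {rmorphism {mpoly C[N]} -> L} := mmap iota a.

Let good (G : set (L * dual L)%type) :=
  [/\ partial_hom G, lift_re G & forall P, G (ev P, (ev P, point_der ev c P))].

Let good0 :
  good [set z | exists P, z = (ev P, (ev P, point_der ev c P) : dual L)].
Proof.
split; last by move=> P; exists P.
- split; first split.
  + by exists 1; rewrite rmorph1 -mpolyC1 point_derC.
  + move=> _ _ [P ->] [Q ->]; exists (P - Q).
    by rewrite rmorphB point_derB.
  + move=> _ _ [P ->] [Q ->]; exists (P * Q).
    by rewrite rmorphM point_derM.
  + by move=> w [P [/esym/a_indep -> ->]]; rewrite rmorph0 -mpolyC0 point_derC.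
- by move=> u e [P [-> ->]].
Qed.

(** Zorn's lemma on graphs of derivations defined on subrings. The start is the derivative in
    direction [c] on the ring generated by [a], well defined because [a] is independent; a maximal
    graph is total by [dual_phom_adjoin]. *)
Lemma derivation_exists : exists D : L -> L,
  [/\ forall u v, D (u + v) = D u + D v,
      forall u v, D (u * v) = u * D v + D u * v,
      forall z, D (iota z) = 0 & forall j, D (a j) = c j].
Proof.
have [F Fgood Ftot|G [Ggood Gmax]] := @Zorn_bigcup (L * dual L)%type
    [set G | G = set0 \/ good G].
  have [[X [FX X0]]|noX] := pselect (exists X, F X /\ X <> set0); last first.
    left; apply/seteqP; split=> // z [X FX Xz]; apply: noX; exists X; split=> //.
    by move=> X0; rewrite X0 in Xz.
  right; have [//|[[[X1 _ _] _] _ Xev]] := Fgood _ FX.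
  have mem2 u v : (\bigcup_(X in F) X) u -> (\bigcup_(X in F) X) v ->
      exists Y, [/\ F Y, good Y, Y u & Y v].
    move=> [Y1 FY1 Y1u] [Y2 FY2 Y2v].
    have [Y12|Y21] := Ftot _ _ FY1 FY2.
      have [Y20|?] := Fgood _ FY2; first by rewrite Y20 in Y2v.
      by exists Y2; split=> //; exact: Y12.
    have [Y10|?] := Fgood _ FY1; first by rewrite Y10 in Y1u.
    by exists Y1; split=> //; exact: Y21.
  split.
  - split; first split.
    + by exists X.
    + move=> u v Uu Uv; have [Y [FY [[[_ YB _] _] _ _] Yu Yv]] := mem2 _ _ Uu Uv.
      by exists Y => //; exact: YB.
    + move=> u v Uu Uv; have [Y [FY [[[_ _ YM] _] _ _] Yu Yv]] := mem2 _ _ Uu Uv.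
      by exists Y => //; exact: YM.
    + move=> w Uw; have [Y [FY [[_ Yinj] _ _] Yu _]] := mem2 _ _ Uw Uw.
      exact: Yinj.
  - move=> u e Uu; have [Y [FY [_ Yre _] Yu _]] := mem2 _ _ Uu Uu.
    exact: Yre.
  - by move=> P; exists X.
have {Ggood} [G0|Ggood] := Ggood.
  exfalso; apply: (Gmax _ _ (or_intror good0)); rewrite G0; split=> // h.
  by have := h _ (ex_intro _ 0 erefl).
have [[[G1 GB GM] Ginj] Gre Gev] := Ggood.
have total u : exists w, G (u, (u, w)).
  have [w hw] := dual_phom_adjoin u (conj (And3 G1 GB GM) Ginj) Gre.
  have sG := And3 G1 GB GM.
  have -> : G = adjoin G (u, (u, w)).
    apply/seteqP; split=> [z|]; first exact: sub_adjoin.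
    apply: contrapT => nsub; apply: (Gmax (adjoin G (u, (u, w)))).
      by split=> // z; exact: sub_adjoin.
    right; split=> //; last by move=> P; exact: sub_adjoin.
    move=> u' e [P hP]; rewrite horner_pair => -[<- <-].
    rewrite -(map_re Gre hP) /=.
    by rewrite -[u in RHS]/(dual_re ((u, w) : dual L)) horner_map.
  by exists w; exact: mem_adjoin.
have [D hD] := choice total.
have D_uniq u w : G (u, (u, w)) -> D u = w.
  move=> h; have := GB _ _ (hD u) h; rewrite /= => h'.
  have /Ginj : G (0, (0, D u - w)) by rewrite -(subrr u).
  by move=> [/eqP]; rewrite subr_eq0 => /eqP.
have GD u v : G u -> G v -> G (u + v) by exact: subring_setD.
exists D; split.
- by move=> u v; apply: D_uniq; exact: (GD _ _ (hD u) (hD v)).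
- by move=> u v; apply: D_uniq; exact: (GM _ _ (hD u) (hD v)).
- move=> z; apply: D_uniq; have := Gev z%:MP.
  by rewrite point_derC /ev /= mmapC.
- move=> j; apply: D_uniq; have := Gev 'X_j.
  by rewrite point_derX /ev /= mmapX mmap1U.
Qed.

End DerivationExists.

(** * Nullstellensatz *)

Section MpolyMorphisms.

Lemma mpoly_ring_ind (C : comNzRingType) n (Q : {mpoly C[n]} -> Prop) :
  (forall c, Q c%:MP) -> (forall i, Q 'X_i) ->
  (forall f g, Q f -> Q g -> Q (f + g)) ->
  (forall f g, Q f -> Q g -> Q (f * g)) -> forall f, Q f.
Proof.
move=> QC QX QD QM; elim/mpolyind => [|c m p _ _ Qp]; first by rewrite -mpolyC0.
apply: QD => //; rewrite -mul_mpolyC; apply: (QM) => //.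
rewrite mpolyXE_id; apply: (big_ind Q); [by rewrite -mpolyC1 | exact: QM | move=> i _].
by elim: (m i) => [|k IH]; rewrite ?expr0 -?mpolyC1 // exprS; apply: QM.
Qed.

Lemma mmap_XU (C S : comNzRingType) n (f : {rmorphism C -> S}) (h : 'I_n -> S) i :
  mmap f h 'X_i = h i.
Proof. by rewrite mmapX mmap1U. Qed.

Lemma rmorph_mmap (C S T : comNzRingType) n (f : {rmorphism C -> S})
  (h : 'I_n -> S) (phi : {rmorphism S -> T}) (g : {rmorphism C -> T})
  (k : 'I_n -> T) (p : {mpoly C[n]}) :
  (forall c, phi (f c) = g c) -> (forall i, phi (h i) = k i) ->
  phi (mmap f h p) = mmap g k p.
Proof.
move=> fg hk; elim/mpoly_ring_ind: p => [c|i|p q|p q].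
- by rewrite !mmapC fg.
- by rewrite !mmap_XU hk.
- by rewrite !rmorphD /= => -> ->.
- by rewrite !rmorphM /= => -> ->.
Qed.

Lemma mmap_mpolyC_id (C : comNzRingType) n (f : {mpoly C[n]}) :
  mmap (@mpolyC n C) (fun i => 'X_i) f = f.
Proof.
elim/mpoly_ring_ind: f => [c|i|p q hp hq|p q hp hq].
- by rewrite mmapC.
- by rewrite mmap_XU.
- by rewrite rmorphD /= hp hq.
- by rewrite rmorphM /= hp hq.
Qed.

Lemma rmorph_mpolyE (C S : comNzRingType) n (psi : {rmorphism {mpoly C[n]} -> S}) f :
  psi f = mmap (psi \o @mpolyC n C) (fun i => psi 'X_i) f.
Proof.
rewrite -{1}[f]mmap_mpolyC_id.
by rewrite (rmorph_mmap (g := psi \o @mpolyC n C) (k := fun i => psi 'X_i)).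
Qed.

Lemma derivation_mmap (C L : comNzRingType) n (iota : {rmorphism C -> L})
  (eta : 'I_n -> L) (D : L -> L) :
  (forall u v, D (u + v) = D u + D v) ->
  (forall u v, D (u * v) = u * D v + D u * v) ->
  (forall c, D (iota c) = 0) ->
  forall f, D (mmap iota eta f) = point_der (mmap iota eta) (D \o eta) f.
Proof.
move=> DD DM DC; elim/mpoly_ring_ind => [c|i|f g|f g].
- by rewrite mmapC DC point_derC.
- by rewrite mmap_XU point_derX.
- by move=> hf hg; rewrite rmorphD /= DD hf hg point_derD.
- by move=> hf hg; rewrite rmorphM /= DM hf hg point_derM.
Qed.

End MpolyMorphisms.

(** A root of [p - 1] is not a root of [p]; if [p - 1] is a non-zero constant, then [p] is constant
    as well. *)
Lemma closed_nonroot (K : closedFieldType) (p : {poly K}) :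
  p != 0 -> exists e, p.[e] != 0.
Proof.
move=> p0; have [/eqP/size_poly1P [c c0 e]|sp] := eqVneq (size (p - 1)) 1%N.
  exists 0; have [c1|c1] := eqVneq (c + 1) 0.
    by move/eqP: p0; case; rewrite -[p](subrK 1) e -polyC1 -polyCD c1 polyC0.
  by rewrite -[p](subrK 1) e !hornerE.
have /closed_rootP [e] := sp.
rewrite rootE !hornerE subr_eq0 => /eqP pe; exists e.
by rewrite pe oner_eq0.
Qed.

Section Nullstellensatz.
Variables (K : closedFieldType) (L : fieldType) (iota : {rmorphism K -> L}).

(* Prescribing an element that must not be killed is what makes the property
   pass from [S] to [adjoin S x]. *)
Let specializable (S : set L) := subring_set S /\ forall u, S u -> u != 0 ->
  exists G : set (L * K)%type,
    [/\ partial_hom G, phom_dom G = S, forall z, G (iota z, z) &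
        exists2 w, G (u, w) & w != 0].

Let specializable_base : specializable (range iota).
Proof.
split; first split.
- by exists 1 => //; rewrite rmorph1.
- by move=> _ _ [u _ <-] [v _ <-]; exists (u - v); rewrite // rmorphB.
- by move=> _ _ [u _ <-] [v _ <-]; exists (u * v); rewrite // rmorphM.
move=> _ [u _ <-] u0; exists [set z | z.1 = iota z.2].
split=> //; last by exists u => //; apply: contraNneq u0 => ->; rewrite rmorph0.
- split; first split=> /=.
  + by rewrite rmorph1.
  + by move=> [a b] [c d] /= -> ->; rewrite rmorphB.
  + by move=> [a b] [c d] /= -> ->; rewrite rmorphM.
  + by move=> w /= /esym/eqP; rewrite fmorph_eq0 => /eqP.
- apply/seteqP; split=> [a [w /= ->]|_ [w _ <-]]; first by exists w.
  by exists w.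
Qed.

(** For x transcendental, keep the leading coefficient of [f] alive and send x to a non-root of the
    image of [f]. For x algebraic, keep alive the leading coefficient of [mu] and a non-zero [c] =
    a(x) f(x) in [S]: the image of [mu] keeps its degree, so it has a root, and f(x) cannot go to 0
    since it divides [c]. *)
Let specializable_adjoin S x : specializable S -> specializable (adjoin S x).
Proof.
move=> [sS spec]; split; first exact: adjoin_subring.
move=> _ [f hf <-] fx.
have f0 : f != 0 by apply: contraNneq fx => ->; rewrite horner0.
have lead0 (p : {poly L}) : p != 0 -> lead_coef p != 0 by rewrite lead_coef_eq0.
have [tr|[mu [hmu mu0 mux min]]] := minpoly_dichotomy S x.
  have [G [hG dG GC [w Gw w0]]] := spec _ (hf _) (lead0 _ f0).
  have [P [hP Pf sP]] : exists P,
      [/\ poly_over G P, map_poly fst P = f & size P = size f].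
    by apply: phom_lift => //; rewrite dG.
  have P2 : map_poly snd P != 0.
    apply: contraNneq w0 => P20; apply/eqP; apply: (phom_fun hG Gw).
    have := hP (size f).-1; rewrite [P`__]surjective_pairing.
    have -> : (P`_(size f).-1).1 = f`_(size f).-1 by rewrite -{2}Pf coef_map.
    have -> // : (P`_(size f).-1).2 = 0.
    by rewrite -[LHS]/(snd P`_(size f).-1) -coef_map P20 coef0.
  have [e he] := closed_nonroot P2.
  exists (adjoin G (x, e)); split.
  - by apply: phom_adjoin_transc; rewrite ?dG.
  - by rewrite phom_dom_adjoin // dG.
  - by move=> z; apply: sub_adjoin => //; case: hG.
  - by exists (map_poly snd P).[e] => //; exists P; rewrite // horner_pair Pf.
have [a [c [ha Sc c0 eac]]] := adjoin_inv_mod sS hmu mu0 mux min hf fx.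
have [_ _ SM] := sS.
have [G [hG dG GC [w Gw w0]]] :=
  spec _ (SM _ _ (hmu _) Sc) (mulf_neq0 (lead0 _ mu0) c0).
have sG := proj1 hG; have [_ _ GM] := sG.
have lift p : poly_over S p -> exists P,
    [/\ poly_over G P, map_poly fst P = p & size P = size p].
  by move=> hp; apply: phom_lift => //; rewrite dG.
have [P [hP Pmu sP]] := lift _ hmu.
have [Q [hQ Qf _]] := lift _ hf.
have [A [hA Aa _]] := lift _ ha.
have [c' Gc] : phom_dom G c by rewrite dG.
have ew : (lead_coef P).2 * c' = w.
  apply: (phom_fun hG) Gw; have := GM _ _ (hP (size P).-1) Gc.
  rewrite [P`__]surjective_pairing.
  have -> // : (P`_(size P).-1).1 = mu`_(size mu).-1 by rewrite -sP -Pmu coef_map.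
move: w0; rewrite -ew mulf_eq0 negb_or => /andP[lP0 c'0].
have sP2 : size (map_poly snd P) = size mu.
  by rewrite size_map_poly_id0 // sP.
have /closed_rootP [e /eqP Pe] : size (map_poly snd P) != 1%N.
  by rewrite sP2; have := size_minpoly mu0 mux; case: (size mu) => [|[]].
have hG' : partial_hom (adjoin G (x, e)).
  apply: (phom_adjoin_alg hG mu0 mux) hP _ _ _ _ => //; first by rewrite dG.
  by move=> v /eqP; rewrite mulf_eq0 (negPf lP0) => /eqP.
exists (adjoin G (x, e)); split=> //.
- by rewrite phom_dom_adjoin // dG.
- by move=> z; exact: sub_adjoin.
- have GQ : adjoin G (x, e) (f.[x], (map_poly snd Q).[e]).
    by exists Q; rewrite // horner_pair Qf.
  exists (map_poly snd Q).[e] => //; apply: contraNneq c'0 => Qe.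
  have GA : adjoin G (x, e) (a.[x], (map_poly snd A).[e]).
    by exists A; rewrite // horner_pair Aa.
  have [_ _ GM'] := proj1 hG'; have := GM' _ _ GA GQ.
  rewrite Qe -[X in adjoin _ _ X]/(_ * _, _ * _) eac mulr0 => h.
  by apply/eqP/(phom_fun hG' _ h)/sub_adjoin.
Qed.

(** Adjoining the [eta i] to K one by one yields a specializable ring containing the value of [f];
    the images of the [eta i] are the coordinates of [y]. *)
Lemma nullstellensatz_point n (eta : 'I_n -> L) (f : {mpoly K[n]}) :
  mmap iota eta f != 0 -> exists y : 'I_n -> K,
    (forall g, mmap iota eta g = 0 -> g.@[y] = 0) /\ f.@[y] != 0.
Proof.
move=> fx.
have [S [[sS spec] SC Seta]] : exists S,
    [/\ specializable S, forall z, S (iota z) & forall i, S (eta i)].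
  have [S [hS SC Sall]] : exists S, [/\ specializable S, forall z, S (iota z) &
      forall i, i \in enum 'I_n -> S (eta i)].
    elim: (enum 'I_n) => [|i s [S [hS SC Ss]]].
      exists (range iota); split=> [|z|//]; first exact: specializable_base.
      by exists z.
    have sS := proj1 hS; exists (adjoin S (eta i)); split.
    - exact: specializable_adjoin.
    - by move=> z; exact: sub_adjoin.
    - move=> j; rewrite inE => /orP[/eqP ->|/Ss]; first exact: mem_adjoin.
      exact: sub_adjoin.
  by exists S; split=> // i; apply: Sall; rewrite mem_enum.
have [S1 SB SM] := sS.
have Sev g : S (mmap iota eta g).
  elim/mpoly_ring_ind: g => [c|i|g h|g h].
  - by rewrite mmapC; exact: SC.
  - by rewrite mmap_XU; exact: Seta.
  - by rewrite rmorphD /=; exact: subring_setD.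
  - by rewrite rmorphM /=; exact: SM.
have [G [hG dG GC [w Gw w0]]] := spec _ (Sev f) fx.
have hz i : exists z, G (eta i, z) by have := Seta i; rewrite -dG.
have [y hy] := choice hz.
have [_ _ GM] := proj1 hG.
have Gev g : G (mmap iota eta g, g.@[y]).
  elim/mpoly_ring_ind: g => [c|i|g h hg hh|g h hg hh].
  - by rewrite mmapC mevalC; exact: GC.
  - by rewrite mmap_XU mevalXU; exact: hy.
  - rewrite rmorphD mevalD; exact: (subring_setD (proj1 hG) hg hh).
  - rewrite rmorphM mevalM; exact: (GM _ _ hg hh).
exists y; split=> [g g0|]; last by rewrite (phom_fun hG (Gev f) Gw).
by apply: (proj2 hG); rewrite -g0.
Qed.

End Nullstellensatz.

(** * Dimension bound at a regular point *)

Section GenericPoint.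
Variables (K : fieldType) (n : nat).
Implicit Types (Z A B : set 'rV[K]_n) (f g : {mpoly K[n]}).

Lemma zeros1P f : zeros [set f] = [set x : 'rV[K]_n | f.@[x 0] = 0].
Proof. by apply/seteqP; split=> x /= h; [exact: h | move=> _ ->]. Qed.

Lemma closed_zeros1 f : zariski_closed (zeros [set f]).
Proof. by exists [set f]. Qed.

Lemma closed_sub_zeros1 A y : zariski_closed A -> ~ A y ->
  exists2 f, vanishing_ideal A f & f.@[y 0] != 0.
Proof.
move=> [E ->] nAy; apply: contrapT => h; apply: nAy => f Ef.
apply/eqP/negP => /negP fy; apply: h; exists f => // x; exact.
Qed.

Lemma vanishing_ideal_prime Z f g : irreducible_closed Z ->
  vanishing_ideal Z (f * g) -> vanishing_ideal Z f \/ vanishing_ideal Z g.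
Proof.
move=> [_ _ irr] fg.
have [|||Zf|Zg] := irr (zeros [set f]) (zeros [set g]).
- exact: closed_zeros1.
- exact: closed_zeros1.
- rewrite !zeros1P => x /fg; rewrite mevalM => /eqP.
  by rewrite mulf_eq0 => /orP[] /eqP; [left|right].
- by left; move: Zf; rewrite zeros1P.
- by right; move: Zg; rewrite zeros1P.
Qed.

(** [L] is the function field of [Z], and [psi] is evaluation at its generic point. *)
Lemma irreducible_generic_point Z : irreducible_closed Z ->
  exists (L : fieldType) (psi : {rmorphism {mpoly K[n]} -> L}),
    forall f, psi f = 0 <-> vanishing_ideal Z f.
Proof.
move=> hZ; have [_ [z Zz] _] := hZ.
have [||||f g|L [psi [h _]]] := @prime_quotient_field _ (vanishing_ideal Z).
- by move=> x _; rewrite meval0.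
- by move=> u v hu hv x Zx; rewrite mevalB hu ?hv ?subrr.
- by move=> u v hv x Zx; rewrite mevalM hv ?mulr0.
- by move=> /(_ _ Zz)/eqP; rewrite meval1 oner_eq0.
- exact: vanishing_ideal_prime.
by exists L, psi.
Qed.

End GenericPoint.

Section JacobianMatrix.
Variables (K : fieldType) (n : nat).

Definition jac_mx r (G : 'I_r -> {mpoly K[n]}) : 'M[{mpoly K[n]}]_(r, n) :=
  \matrix_(k, l) (G k)^`M(l).

Lemma map_jac_mx r (G : 'I_r -> {mpoly K[n]}) (x : 'rV[K]_n) :
  map_mx (meval (x 0)) (jac_mx G) = jacobian G x.
Proof. by apply/matrixP => k l; rewrite !mxE. Qed.

(** Rank can only drop under specialization: lift a right inverse at [x] to a constant matrix; the
    determinant of the product is non-zero at [x], hence also under [psi]. *)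
Lemma row_free_specialize (L : fieldType) (psi : {rmorphism {mpoly K[n]} -> L})
  (x : 'rV[K]_n) m (M : 'M[{mpoly K[n]}]_(m, n)) :
  (forall f, psi f = 0 -> f.@[x 0] = 0) ->
  row_free (map_mx (meval (x 0)) M) -> row_free (map_mx psi M).
Proof.
move=> hpsi /row_freeP [B MB]; pose BP := map_mx (@mpolyC n K) B.
have BPx : map_mx (meval (x 0)) BP = B.
  by apply/matrixP => k l; rewrite !mxE mevalC.
have det0 : psi (\det (M *m BP)) != 0.
  apply/eqP => /hpsi /eqP; rewrite -[X in X == 0]/(meval _ _) -det_map_mx map_mxM.
  by rewrite BPx MB det1 oner_eq0.
rewrite /row_free eqn_leq rank_leq_row /=.
apply: leq_trans (mxrankM_maxl _ (map_mx psi BP)).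
by rewrite -map_mxM mxrank_unit // unitmxE det_map_mx unitfE.
Qed.

End JacobianMatrix.

(** The partial derivatives with respect to the independent functions [g] extend to derivations of
    the function field. Their values on the coordinates are the rows of [V]: [e] independent vectors
    killed by the differentials of [G], which remain independent at the generic point. *)
Lemma irreducible_dim_le (K : fieldType) n (Z : set 'rV[K]_n) (x : 'rV[K]_n) r
  (G : 'I_r -> {mpoly K[n]}) e :
  (forall k, k.+1%:R != 0 :> K) -> irreducible_closed Z -> Z x ->
  (forall j, vanishing_ideal Z (G j)) -> row_free (jacobian G x) ->
  has_alg_indep Z e -> (e + r <= n)%N.
Proof.
move=> char0 hZ Zx GZ Gfree [g g_indep].
have [L [psi psi0]] := irreducible_generic_point hZ.
pose iota : {rmorphism K -> L} := psi \o @mpolyC n K.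
pose eta i := psi 'X_i.
have psiE f : psi f = mmap iota eta f by exact: rmorph_mpolyE.
have char0L k : k.+1%:R != 0 :> L by rewrite -(rmorph_nat iota) fmorph_eq0.
have indep (P : {mpoly K[e]}) : mmap iota (psi \o tnth g) P = 0 -> P = 0.
  move=> P0; apply: g_indep; apply/psi0.
  by rewrite /comp_mpoly (rmorph_mmap (g := iota) (k := psi \o tnth g)).
have derivs j := derivation_exists char0L (fun i => (i == j)%:R) indep.
have [D hD] := choice derivs.
pose V : 'M[L]_(e, n) := \matrix_(j, l) D j (eta l).
have DE j f : D j (psi f) = \sum_l psi (f^`M(l)) * V j l.
  have [DD DM DC _] := hD j; rewrite psiE (derivation_mmap _ DD DM DC).
  by apply: eq_bigr => l _; rewrite /= -psiE !mxE.
have VG : V *m (map_mx psi (jac_mx G))^T = 0.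
  apply/matrixP => j k; have [_ _ DC _] := hD j.
  rewrite [RHS]mxE; transitivity (D j (psi (G k))).
    by rewrite DE mxE; apply: eq_bigr => l _; rewrite mulrC !mxE.
  by have /psi0 -> := GZ k; rewrite -[X in D j X](rmorph0 iota) DC.
have Vg : V *m (map_mx psi (jac_mx (tnth g)))^T = 1%:M.
  apply/matrixP => j k; have [_ _ _ Dg] := hD j.
  rewrite [RHS]mxE eq_sym -Dg /= DE mxE.
  by apply: eq_bigr => l _; rewrite mulrC !mxE.
have Vfree : \rank V = e.
  apply/eqP; rewrite -[_ == _]/(row_free V); apply/row_freeP.
  by exists (map_mx psi (jac_mx (tnth g)))^T.
have := mulmx0_rank_max VG; rewrite Vfree mxrank_tr.
suff /eqP -> : row_free (map_mx psi (jac_mx G)) by [].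
apply: (@row_free_specialize _ _ _ _ x) => [f /psi0|]; first exact.
by rewrite map_jac_mx.
Qed.

(** * Formal solutions of a system of equations *)

Section XadicCongruence.
Variable D : comNzRingType.
Implicit Types p q u : {poly D}.

Definition eqmodX k p q : Prop := exists u, p = q + u * 'X^k.

Lemma eqmodX_refl k p : eqmodX k p p.
Proof. by exists 0; rewrite mul0r addr0. Qed.

Lemma eqmodX_sym k p q : eqmodX k p q -> eqmodX k q p.
Proof. by move=> [u ->]; exists (- u); rewrite mulNr addrK. Qed.

Lemma eqmodX_trans k p q s : eqmodX k p q -> eqmodX k q s -> eqmodX k p s.
Proof. by move=> [u ->] [v ->]; exists (u + v); rewrite mulrDl; ring. Qed.

Lemma eqmodXD k p q p' q' :
  eqmodX k p q -> eqmodX k p' q' -> eqmodX k (p + p') (q + q').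
Proof. by move=> [u ->] [v ->]; exists (u + v); ring. Qed.

Lemma eqmodXM k p q p' q' :
  eqmodX k p q -> eqmodX k p' q' -> eqmodX k (p * p') (q * q').
Proof.
move=> [u ->] [v ->]; exists (u * (q' + v * 'X^k) + q * v); ring.
Qed.

Lemma eqmodX_le j k p q : (j <= k)%N -> eqmodX k p q -> eqmodX j p q.
Proof.
move=> jk [u ->]; exists (u * 'X^(k - j)).
by rewrite -mulrA -exprD subnK.
Qed.

Lemma eqmodX_coef0 k p q : eqmodX k.+1 p q -> p`_0 = q`_0.
Proof. by move=> [u ->]; rewrite exprS mulrCA coefD coefXM addr0. Qed.

Lemma eqmodX_polyC k c : eqmodX k.+1 c%:P 0 -> c = 0.
Proof. by move=> /eqmodX_coef0; rewrite coefC coef0. Qed.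

Lemma eqmodX_eq0 p : (forall k, eqmodX k.+1 p 0) -> p = 0.
Proof.
move=> h; apply/polyP => i; have [u ->] := h i.
by rewrite add0r coefMXn ltnS leqnn coef0.
Qed.

Variables (C : comNzRingType) (iota : {rmorphism C -> {poly D}}) (n : nat).
Implicit Types Y : 'I_n -> {poly D}.

Lemma eqmodX_mmap k Y Y' (f : {mpoly C[n]}) : (forall l, eqmodX k (Y l) (Y' l)) ->
  eqmodX k (mmap iota Y f) (mmap iota Y' f).
Proof.
move=> hY; elim/mpoly_ring_ind: f => [c|i|f g hf hg|f g hf hg].
- by rewrite !mmapC; exact: eqmodX_refl.
- by rewrite !mmap_XU.
- by rewrite !rmorphD /=; exact: eqmodXD.
- by rewrite !rmorphM /=; exact: eqmodXM.
Qed.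

(** First-order Taylor expansion. The square of the increment has order 2m+2, at least m+2, and the
    derivative may be taken at [Y0] since [Y] agrees with it modulo ['X]. *)
Lemma eqmodX_taylor m (Y0 Y delta : 'I_n -> {poly D}) (f : {mpoly C[n]}) :
  (forall l, eqmodX 1 (Y l) (Y0 l)) ->
  eqmodX m.+2 (mmap iota (fun l => Y l + 'X^(m.+1) * delta l) f)
    (mmap iota Y f + 'X^(m.+1) * point_der (mmap iota Y0) delta f).
Proof.
move=> hY; elim/mpoly_ring_ind: f => [c|i|f g [u hu] [v hv]|f g [u hu] [v hv]].
- by rewrite !mmapC point_derC mulr0 addr0; exact: eqmodX_refl.
- by rewrite !mmap_XU point_derX; exact: eqmodX_refl.
- exists (u + v); rewrite !rmorphD /= hu hv point_derD; ring.
have [a ha] := eqmodX_mmap f hY; have [b hb] := eqmodX_mmap g hY.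
rewrite !rmorphM /= hu hv point_derM /= ha hb.
move: (mmap _ _ f) (mmap _ _ g) (point_der _ _ f) (point_der _ _ g).
move=> fx gx df dg; pose t : {poly D} := 'X^m.
exists (a * dg + b * df + t * df * dg + v * (fx + a * 'X)
  + u * (gx + b * 'X) + u * 'X * t * dg + v * 'X * t * df + u * v * 'X^2 * t).
by rewrite !exprS -/t expr0 !mulr1; ring.
Qed.

End XadicCongruence.

(** Additivity of the order in ['X] over a domain: strip factors ['X] from [p] while its constant
    term is zero; once it is non-zero, all of them must come from [q]. *)
Lemma eqmodX_prime (D : idomainType) a b (p q : {poly D}) :
  eqmodX (a + b) (p * q) 0 -> eqmodX a p 0 \/ eqmodX b q 0.
Proof.
have divX (s : {poly D}) : s`_0 = 0 -> exists s', s = s' * 'X.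
  move=> s0; have /factor_theorem [s' ->] : root s 0 by rewrite rootE horner_coef0 s0.
  by exists s'; rewrite subr0.
have cancelX (s u : {poly D}) k : s * 'X = u * 'X^(k.+1) -> s = u * 'X^k.
  by rewrite exprSr mulrA => /mulIf; apply; rewrite polyX_eq0.
elim: a p => [|a IH] p; first by move=> _; left; exists p; rewrite add0r expr0 mulr1.
have [p0|p0] := eqVneq p`_0 0.
  have [p' ->] := divX _ p0 => -[u]; rewrite add0r mulrAC addSn => /cancelX h.
  have [|[v ->]|hq] := IH p'; last by right.
    by exists u; rewrite add0r.
  by left; exists v; rewrite !add0r exprSr mulrA.
move=> /(eqmodX_le (leq_addl _ _)) h; right.
elim: b q {IH} h => [|b IHb] q; first by move=> _; exists q; rewrite add0r expr0 mulr1.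
move=> h; have q0 : q`_0 = 0.
  have := eqmodX_coef0 h; rewrite coef0M coef0 => /eqP.
  by rewrite mulf_eq0 (negPf p0) => /eqP.
have [q' eq] := divX _ q0; move: h => [u]; rewrite eq add0r mulrA => /cancelX h.
have [|v ->] := IHb q'; first by exists u; rewrite add0r.
by exists v; rewrite !add0r exprSr mulrA.
Qed.

Lemma sum_delta (A B : comNzRingType) (phi : {rmorphism A -> B}) m (i : 'I_m)
  (F : 'I_m -> B) : \sum_j phi (i == j)%:R * F j = F i.
Proof.
rewrite (bigD1 i) //= eqxx rmorph1 mul1r big1 ?addr0 // => j.
by rewrite eq_sym => /negPf ->; rewrite rmorph0 mul0r.
Qed.

Lemma sum_mulmx (A B : comNzRingType) (phi : {rmorphism A -> B}) m n k
  (M : 'M[A]_(m, n)) (N : 'M[A]_(n, k)) i j (y : B) :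
  \sum_l phi (M i l) * (phi (N l j) * y) = phi ((M *m N) i j) * y.
Proof.
rewrite mxE rmorph_sum mulr_suml; apply: eq_bigr => l _.
by rewrite rmorphM mulrA.
Qed.

(* Newton iteration with a fixed right inverse [J] of the Jacobian: [curve k]
   solves [G = 0] modulo ['X^k.+1] over K[t_1..t_d]. The correction steps stay in
   the span of the rows of [J^T], which [E] kills, so [E] reads off the
   parameters t exactly at every stage. *)
Section FormalSolution.
Variables (K : fieldType) (n r d : nat) (x : 'rV[K]_n).
Variables (G : 'I_r -> {mpoly K[n]}).
Hypothesis Gx : forall j, (G j).@[x 0] = 0.
Variables (J : 'M[K]_(n, r)) (E : 'M[K]_(n, d)) (V : 'M[K]_(d, n)).
Hypotheses (GJ : jacobian G x *m J = 1%:M) (JE : J^T *m E = 0).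
Hypothesis VE : V *m E = 1%:M.

Local Notation D := {mpoly K[d]}.

Let cst : {rmorphism K -> {poly D}} := polyC \o @mpolyC d K.
Let base (l : 'I_n) : {poly D} := cst (x 0 l).
Let ev (Y : 'I_n -> {poly D}) : {rmorphism {mpoly K[n]} -> {poly D}} :=
  mmap cst Y.

Let correction (Y : 'I_n -> {poly D}) k (l : 'I_n) : {poly D} :=
  - \sum_j cst (J l j) * ((ev Y (G j))`_k.+1)%:P.

(** The variable ['X] scales the parameters t_i, so truncation in ['X] stands for truncation by
    degree in t. *)
Fixpoint curve k (l : 'I_n) : {poly D} :=
  if k is k'.+1 then curve k' l + 'X^k * correction (curve k') k' l
  else base l + 'X * \sum_i cst (V i l) * ('X_i)%:P.

Lemma curve_base k l : eqmodX 1 (curve k l) (base l).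
Proof.
elim: k => [|k IH] /=.
  by exists (\sum_i cst (V i l) * ('X_i)%:P); rewrite expr1 mulrC.
apply: eqmodX_trans IH; exists ('X^k * correction (curve k) k l).
by rewrite expr1 exprS; ring.
Qed.

Lemma ev_base f : ev base f = cst f.@[x 0].
Proof. by rewrite /ev /= -(rmorph_mmap (phi := cst) (f := idfun) (h := x 0)). Qed.

Lemma ev_curve_base k f : eqmodX 1 (ev (curve k) f) (cst f.@[x 0]).
Proof. by rewrite -ev_base; apply: eqmodX_mmap; exact: curve_base. Qed.

Lemma curve_eq k j : eqmodX k.+1 (ev (curve k) (G j)) 0.
Proof.
elim: k j => [|k IH] j.
  have := ev_curve_base 0 (G j); rewrite Gx rmorph0; exact.
rewrite -[ev _ _]/(mmap cst (fun l => curve k l +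
  'X^(k.+1) * correction (curve k) k l) (G j)).
apply: eqmodX_trans (eqmodX_taylor _ _ _ _ (curve_base k)) _.
have [u hu] := choice IH.
have coefE i : (ev (curve k) (G i))`_k.+1 = (u i)`_0.
  by rewrite hu add0r coefMXn ltnn subnn.
(* Since [J] is a right inverse of the Jacobian, the correction changes [G j] to first order by
   minus its coefficient at ['X^k.+1]. *)
have -> : point_der (mmap cst base) (correction (curve k) k) (G j) =
    - ((u j)`_0)%:P.
  rewrite /point_der; under eq_bigr => l _.
    rewrite -/(ev base _) ev_base /correction mulrN mulr_sumr; over.
  rewrite sumrN exchange_big /=; congr (- _).
  have sumE i : \sum_l cst ((G j)^`M(l)).@[x 0] *
      (cst (J l i) * ((ev (curve k) (G i))`_k.+1)%:P) = cst (j == i)%:R * ((u i)`_0)%:P.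
    have := sum_mulmx cst (jacobian G x) J j i ((u i)`_0)%:P.
    rewrite GJ mxE => <-; apply: eq_bigr => l _.
    by rewrite coefE [jacobian _ _ _ _]mxE.
  under eq_bigr => i _ do rewrite sumE.
  exact: sum_delta.
rewrite -/(ev (curve k) _) hu add0r mulrN -(mulrC _%:P) -mulrBl.
have : root (u j - ((u j)`_0)%:P) 0 by rewrite rootE !hornerE horner_coef0 subrr.
move=> /factor_theorem [v ->]; exists v.
by rewrite subr0 add0r -mulrA -exprS.
Qed.

Lemma curve_coherent k m : (k <= m)%N -> forall l, eqmodX k.+1 (curve m l) (curve k l).
Proof.
elim: m => [|m IH]; first by rewrite leqn0 => /eqP -> l; exact: eqmodX_refl.
rewrite leq_eqVlt => /orP[/eqP <- l|]; first exact: eqmodX_refl.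
rewrite ltnS => km l; apply: eqmodX_trans (IH km l) => /=.
apply: (@eqmodX_le _ k.+1 m.+1) => //.
by exists (correction (curve m) m l); rewrite mulrC.
Qed.

Lemma ev_curve_coherent k m f : (k <= m)%N ->
  eqmodX k.+1 (ev (curve m) f) (ev (curve k) f).
Proof. by move=> km; apply: eqmodX_mmap => l; exact: curve_coherent. Qed.

Lemma curve_coord k i : \sum_l (curve k l - base l) * cst (E l i) = 'X * ('X_i)%:P.
Proof.
elim: k => [|k IH] /=.
  transitivity ('X * \sum_j \sum_l cst (V j l) * (cst (E l i) * ('X_j)%:P)).
    rewrite exchange_big /= mulr_sumr; apply: eq_bigr => l _.
    rewrite (addrC (base l)) addrK -mulrA mulr_suml; congr (_ * _).
    by apply: eq_bigr => j _; rewrite -mulrA (mulrC ('X_j)%:P).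
  congr (_ * _); under eq_bigr => j _ do rewrite sum_mulmx VE mxE eq_sym.
  exact: sum_delta.
rewrite -[RHS]addr0 -IH.
under eq_bigr => l _ do rewrite addrAC mulrDl.
rewrite big_split /=; congr (_ + _).
transitivity (- 'X^(k.+1) * \sum_j \sum_l
    cst (J^T j l) * (cst (E l i) * ((ev (curve k) (G j))`_k.+1)%:P)).
  rewrite exchange_big /= mulr_sumr; apply: eq_bigr => l _.
  rewrite mulNr -mulrA mulNr mulrN mulr_suml; congr (- (_ * _)).
  by apply: eq_bigr => j _; rewrite [J^T _ _]mxE -!mulrA (mulrC (cst (E l i))).
rewrite big1 ?mulr0 // => j _.
by rewrite sum_mulmx JE mxE rmorph0 mul0r.
Qed.

(** Polynomials vanishing on the limit of the curves. The power series limit is never formed: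
    [curve k] represents it modulo ['X^k.+1]. *)
Definition formal_ideal (f : {mpoly K[n]}) : Prop :=
  forall k, eqmodX k.+1 (ev (curve k) f) 0.

Lemma formal_ideal_base f : formal_ideal f -> f.@[x 0] = 0.
Proof.
move=> /(_ 0%N) h; have := eqmodX_trans (eqmodX_sym (ev_curve_base 0 f)) h.
by move=> /eqmodX_polyC /eqP; rewrite mpolyC_eq0 => /eqP.
Qed.

Lemma formal_ideal_prime f g :
  formal_ideal (f * g) -> formal_ideal f \/ formal_ideal g.
Proof.
move=> fg; apply: contrapT => /not_orP [/existsNP [k nf] /existsNP [m ng]].
(* At this stage the modulus has exponent [k.+1 + m.+1], the sum of the two exponents at which [f]
   and [g] are non-zero. *)
have := fg (k + m.+1)%N; rewrite rmorphM /= -addSn => /eqmodX_prime [] h.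
  apply: nf; apply: eqmodX_trans h; apply: eqmodX_sym; apply: ev_curve_coherent.
  exact: leq_addr.
apply: ng; apply: eqmodX_trans h; apply: eqmodX_sym; apply: ev_curve_coherent.
exact: (leq_trans (leqnSn m) (leq_addl k m.+1)).
Qed.

End FormalSolution.

Lemma exists_row_basis (K : fieldType) m n k (M : 'M[K]_(m, n)) :
  (k <= \rank M)%N -> exists2 B : 'M[K]_(k, n), row_free B & (B <= M)%MS.
Proof.
move=> kM; exists (pid_mx k *m row_base M).
  rewrite /row_free mxrankMfree ?row_base_free // rank_pid_mx //.
by apply: submx_trans (submxMl _ _) _; rewrite eq_row_base.
Qed.

(** [Z] is the zero set of the prime ideal of the formal solution through [x]. The linear forms that
    read off the parameters become X t_i on that solution, hence are algebraically independent on
    [Z]. *)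
Lemma formal_component (K : closedFieldType) n r (x : 'rV[K]_n)
  (G : 'I_r -> {mpoly K[n]}) :
  (forall j, (G j).@[x 0] = 0) -> row_free (jacobian G x) ->
  exists Z, [/\ irreducible_closed Z, Z x, forall j, vanishing_ideal Z (G j) &
    has_alg_indep Z (n - r)].
Proof.
move=> Gx /row_freeP [J GJ].
have rankJ : \rank J = r.
  apply/eqP; rewrite eqn_leq rank_leq_col /=.
  by have := mxrankM_maxr (jacobian G x) J; rewrite GJ mxrank1.
(* The rows of [B] span the left kernel of [J]: they are the forms reading off the parameters, and
   [V] supplies the directions of the parameters. *)
have [|B /row_freeP [V BV] /sub_kermxP BJ] :=
  @exists_row_basis K n n (n - r) (kermx J); first by rewrite mxrank_ker rankJ.
have JE : J^T *m B^T = 0 by rewrite -trmx_mul BJ trmx0.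
have VE : V^T *m B^T = 1%:M by rewrite -trmx_mul BV trmx1.
pose d := (n - r)%N.
pose cst : {rmorphism K -> {poly {mpoly K[d]}}} := polyC \o @mpolyC d K.
pose Y := curve x G J V^T.
pose P := formal_ideal x G J V^T.
have ev0 f : P f -> f.@[x 0] = 0 by exact: formal_ideal_base.
have [||||f g|L [psi [psi0 _]]] := @prime_quotient_field _ P.
- by move=> k; rewrite rmorph0; exact: eqmodX_refl.
- move=> u v hu hv k; rewrite rmorphB /=.
  have [a ->] := hu k; have [b ->] := hv k; exists (a - b); ring.
- move=> u v hv k; rewrite rmorphM /=.
  have [b ->] := hv k; eexists; rewrite !add0r mulrA; reflexivity.
- by move=> /ev0 /eqP; rewrite meval1 oner_eq0.
- exact: formal_ideal_prime.
pose iota : {rmorphism K -> L} := psi \o @mpolyC n K.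
have psiE f : psi f = mmap iota (fun i => psi 'X_i) f by exact: rmorph_mpolyE.
(* Nullstellensatz: a polynomial outside [P] is non-zero at the generic point, hence at some point
   of [zeros P]. *)
have IZ f : vanishing_ideal (zeros P) f -> P f.
  move=> hf; apply/psi0/eqP/negP => /negP f0; rewrite psiE in f0.
  have [y [yP fy]] := nullstellensatz_point f0.
  have yE g : g.@[(\row_i y i) 0] = g.@[y] by apply: meval_eq => i; rewrite mxE.
  have Py : zeros P (\row_i y i).
    by move=> g /psi0; rewrite psiE yE; exact: yP.
  by move/eqP: fy; apply; rewrite -yE; apply: hf.
have Zx : zeros P x by move=> f /ev0.
exists (zeros P); split.
- split; [by exists P | by exists x |].
  move=> A A' cA cA' sub; apply: contrapT => /not_orP [].
  move=> /existsNP [y /not_implyP [Zy nAy]] /existsNP [y' /not_implyP [Zy' nAy']].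
  have [f fA fy] := closed_sub_zeros1 cA nAy.
  have [g gA gy] := closed_sub_zeros1 cA' nAy'.
  have /IZ /formal_ideal_prime [Pf|Pg] : vanishing_ideal (zeros P) (f * g).
    by move=> z /sub [/fA|/gA] e; rewrite mevalM e ?mul0r ?mulr0.
  + by move/eqP: fy; apply; apply: Zy.
  + by move/eqP: gy; apply; apply: Zy'.
- exact: Zx.
- by move=> j y; apply; move=> k; exact: curve_eq.
- exists [tuple \sum_l B i l *: ('X_l - (x 0 l)%:MP) | i < n - r] => Q /IZ QP.
  have w0 : mmap cst (fun i => 'X * ('X_i)%:P) Q = 0.
    apply: eqmodX_eq0 => k; have := QP k; rewrite /comp_mpoly.
    rewrite (rmorph_mmap (g := cst) (k := fun i => 'X * ('X_i)%:P)) //.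
      by move=> c; rewrite /= mmapC.
    move=> i; rewrite tnth_mktuple -(curve_coord x G JE VE k i) rmorph_sum.
    apply: eq_bigr => l _; rewrite -mul_mpolyC rmorphM rmorphB /=.
    by rewrite !mmapC mmap_XU mulrC mxE.
  (* Setting ['X] to 1 turns Q(X t) back into [Q]. *)
  have := congr1 (horner_eval 1) w0; rewrite rmorph0.
  rewrite (rmorph_mmap (g := @mpolyC d K) (k := fun i => 'X_i)).
  + by rewrite mmap_mpolyC_id.
  + by move=> c; exact: (hornerC c%:MP 1).
  + by move=> i; rewrite /= /horner_eval hornerM hornerX hornerC mul1r.
Qed.

(** * Local equations and smoothness *)

Lemma row_freeI (K : fieldType) m n (A : 'M[K]_(m, n)) :
  (forall u : 'rV_m, u *m A = 0 -> u = 0) -> row_free A.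
Proof.
move=> h; rewrite -kermx_eq0; apply/eqP/row_matrixP => i; rewrite row0.
by apply: h; apply/sub_kermxP; exact: row_sub.
Qed.

Definition cat_fun (T : Type) r s (G : 'I_r -> T) (H : 'I_s -> T) (k : 'I_(r + s)) : T :=
  match fintype.split k with inl j => G j | inr j => H j end.

Lemma jacobian_cat (K : fieldType) n r s (G : 'I_r -> {mpoly K[n]})
  (H : 'I_s -> {mpoly K[n]}) x :
  jacobian (cat_fun G H) x = col_mx (jacobian G x) (jacobian H x).
Proof.
by apply/matrixP => k l; rewrite !mxE /cat_fun; case: fintype.split => j; rewrite mxE.
Qed.

(** On the open set where [h] is non-zero, [B] is given by [G]. The formal component [Z] realizes
    the local dimension n - r, and the tangent space is the kernel of the Jacobian of [G]. *)
Lemma smooth_at_local_eq (K : closedFieldType) n r (B : set 'rV[K]_n)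
  (x : 'rV[K]_n) (G : 'I_r -> {mpoly K[n]}) (h : {mpoly K[n]}) :
  (forall k, k.+1%:R != 0 :> K) ->
  (forall j, vanishing_ideal B (G j)) -> B x -> h.@[x 0] != 0 ->
  (forall y : 'rV[K]_n, (forall j, (G j).@[y 0] = 0) -> h.@[y 0] != 0 -> B y) ->
  row_free (jacobian G x) -> smooth_at (zariski_closure B) x.
Proof.
move=> char0 GB Bx hx Bloc Gfree.
have Gx j : (G j).@[x 0] = 0 by exact: GB.
have [Z [irrZ Zx GZ dimZ]] := formal_component Gx Gfree.
have rn : (r <= n)%N.
  by have := irreducible_dim_le char0 irrZ Zx GZ Gfree dimZ; lia.
(* For [f] vanishing on [B], the product [f * h] vanishes on [Z]; since h(x) is non-zero and [Z] is
   irreducible, [f] vanishes on [Z]. *)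
have ZW : Z `<=` zariski_closure B.
  move=> y Zy f fB.
  have [z Zz|Zf|Zh] := @vanishing_ideal_prime _ _ Z f h irrZ.
  - rewrite mevalM; have [->|hz] := eqVneq h.@[z 0] 0; first by rewrite mulr0.
    by rewrite fB ?mul0r //; apply: Bloc => // j; apply: GZ.
  - exact: Zf.
  - by move/eqP: hx; case; apply: Zh.
have IW f : vanishing_ideal (zariski_closure B) f -> vanishing_ideal B f.
  by move=> hf y By; apply: hf => g; apply.
have GW j : vanishing_ideal (zariski_closure B) (G j).
  by move=> y; apply; exact: GB.
have dim_le Z' e : irreducible_closed Z' -> Z' `<=` zariski_closure B -> Z' x ->
    has_alg_indep Z' e -> (e <= n - r)%N.
  move=> irrZ' Z'W Z'x he.
  have := irreducible_dim_le char0 irrZ' Z'x (fun j y Z'y => GW j y (Z'W _ Z'y)) Gfree he.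
  lia.
split; first by move=> f fB; exact: fB.
pose phi : 'Hom('rV[K]_n, 'rV[K]_r) := linfun (mulmxr (jacobian G x)^T).
have phiE v : phi v = v *m (jacobian G x)^T by rewrite lfunE.
exists (lker phi).
have dimT : \dim (lker phi) = (n - r)%N.
  have := limg_ker_dim phi fullv; rewrite capfv.
  have -> : (phi @: fullv)%VS = fullv.
    apply/vspaceP => w; rewrite memvf; apply/memv_imgP.
    have /row_freeP [J GJ] := Gfree; exists (w *m J^T); rewrite ?memvf //.
    by rewrite phiE -mulmxA -trmx_mul GJ trmx1 mulmx1.
  rewrite !dimvf /dim /= !mul1n; lia.
split.
  move=> v; rewrite memv_ker phiE; split=> [/eqP vG f fW|tv]; last first.
    apply/eqP/rowP => j; rewrite !mxE -[RHS](tv _ (GW j)).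
    by apply: eq_bigr => l _; rewrite !mxE mulrC.
  (* Otherwise adding [f] to [G] would give r + 1 independent differentials of functions vanishing
     on [Z], whose dimension would be less than n - r. *)
  apply/eqP/negP => /negP fv.
  have : row_free (jacobian (cat_fun G (fun _ : 'I_1 => f)) x).
    apply: row_freeI => u; rewrite jacobian_cat -[u]hsubmxK mul_row_col => e.
    have u2 : rsubmx u = 0.
      have := congr1 (mulmx^~ v^T) e; rewrite mulmxDl -!mulmxA.
      have -> : jacobian G x *m v^T = 0 by rewrite -[LHS]trmxK trmx_mul trmxK vG trmx0.
      rewrite mulmx0 add0r mul0mx => /matrixP/(_ 0 0); rewrite !mxE big_ord1 !mxE.
      move=> /eqP; rewrite mulf_eq0 => /orP[/eqP u0|/eqP fv0].
        by apply/matrixP => a b; rewrite !ord1 [RHS]mxE -u0 !mxE.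
      move/eqP: fv; case; rewrite -[RHS]fv0.
      by apply: eq_bigr => l _; rewrite !mxE.
    move: e; rewrite u2 mul0mx addr0 => /eqP.
    by rewrite mulmx_free_eq0 // => /eqP ->; rewrite row_mx0.
  move=> G'free; suff G'Z k : vanishing_ideal Z (cat_fun G (fun _ : 'I_1 => f) k).
    by have := irreducible_dim_le char0 irrZ Zx G'Z G'free dimZ; lia.
  move=> y Zy; rewrite /cat_fun; case: fintype.split => j; first exact: GZ.
  by apply: fW; exact: ZW.
rewrite dimT; split.
  exists Z; split=> //; split=> // e; exact: dim_le.
by move=> Z' e irr' Z'W Z'x [he _]; exact: dim_le he.
Qed.

(** * Generic transversality *)

Section Evaluation.
Variables (T : pointedType) (K : fieldType).

Definition eval_at (t : T) (f : T -> K) : K := f t.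

Fact eval_at_zmod t : zmod_morphism (eval_at t). Proof. by []. Qed.
Fact eval_at_monoid t : monoid_morphism (eval_at t). Proof. by []. Qed.
HB.instance Definition _ t :=
  GRing.isZmodMorphism.Build (T -> K) K (eval_at t) (eval_at_zmod t).
HB.instance Definition _ t :=
  GRing.isMonoidMorphism.Build (T -> K) K (eval_at t) (eval_at_monoid t).

Definition cst_fun (c : K) : T -> K := fun=> c.

Fact cst_fun_zmod : zmod_morphism cst_fun. Proof. by []. Qed.
Fact cst_fun_monoid : monoid_morphism cst_fun. Proof. by []. Qed.
HB.instance Definition _ :=
  GRing.isZmodMorphism.Build K (T -> K) cst_fun cst_fun_zmod.
HB.instance Definition _ :=
  GRing.isMonoidMorphism.Build K (T -> K) cst_fun cst_fun_monoid.

(** Functions modulo an ultrafilter refining [F]. The last clause is the transfer principle for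
    finite systems of equations. *)
Lemma ultrapower (F : set_system T) : ProperFilter F ->
  exists (L : fieldType) (psi : {rmorphism (T -> K) -> L}),
  [/\ forall u, F [set t | u t = 0] -> psi u = 0,
      forall u, F [set t | u t != 0] -> psi u != 0,
      forall y, exists u, psi u = y &
      forall (I : finType) (u : I -> T -> K) (S : set T),
        (forall i, psi (u i) = 0) -> F S ->
        exists2 t, S t & forall i, u i t = 0].
Proof.
move=> FF; have [U [UU FU]] := ultraFilterLemma FF.
pose P (u : T -> K) := U [set t | u t = 0].
have nP u : ~ P u -> U [set t | u t != 0].
  have [//|h] := in_ultra_setVsetC [set t | u t = 0] UU => _.
  by apply: filterS h => t /= /eqP.
have [||||u v|L [psi [psi0 surj]]] := @prime_quotient_field (T -> K) P.
- exact: filterE.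
- by move=> u v; apply: filterS2 => t /= ut vt; rewrite -[LHS]/(u t - v t) ut vt subrr.
- by move=> u v; apply: filterS => t /= vt; rewrite -[LHS]/(u t * v t) vt mulr0.
- move=> P1; apply: (@filter_not_empty _ U _); apply: filterS P1 => t /= /eqP.
  by rewrite -[X in X == _]/(1 : K) oner_eq0.
- move=> uv; have [Pu|/nP nu] := pselect (P u); [by left | right].
  apply: filterS2 nu uv => t /= /negPf ut /eqP.
  by rewrite -[X in X == _]/(u t * v t) mulf_eq0 ut => /eqP.
exists L, psi; split.
- by move=> u /FU /psi0.
- move=> u /FU nu; apply/eqP => /psi0 Pu; apply: (@filter_not_empty _ U _).
  by apply: filterS2 nu Pu => t /= /eqP.
- move=> y; have [u [v [v0 ->]]] := surj y.
  (* The pointwise inverse is correct on a set of the ultrafilter, so no fractions are added and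
     [psi] is onto. *)
  have e : psi (fun t => (v t)^-1) * psi v = 1.
    rewrite -rmorphM -(rmorph1 psi); apply/eqP; rewrite -subr_eq0 -rmorphB.
    apply/eqP/psi0; have /nP : ~ P v by move=> /psi0 /eqP; rewrite (negPf v0).
    apply: filterS => t /= vt; rewrite -[LHS]/((v t)^-1 * v t - 1).
    by rewrite mulVf ?subrr.
  exists (u * (fun t => (v t)^-1)); rewrite rmorphM; congr (_ * _).
  by rewrite -[RHS]mul1r -e mulfK.
- move=> I u S u0 FS.
  have h : U (fun t => forall i, u i t = 0).
    by apply: (@filter_forall T I (fun i t => u i t = 0)) => i; apply/psi0.
  apply: contrapT => nt; apply: (@filter_not_empty _ U _).
  by apply: filterS2 (FU _ FS) h => t St ut; apply: nt; exists t.
Qed.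

End Evaluation.

(** * The polar matrix and its derivative *)

Section PolarMatrix.
Variables (K : fieldType) (n p q : nat) (F : 'I_p -> {mpoly K[n]}) (e : K).

(* [e = 0] gives the classic and [e = 1] the dual polar varieties. *)
Definition polar_mx (A : comNzRingType) (iota : {rmorphism K -> A})
    (x : 'rV[A]_n) (a : 'M[A]_(q, n)) : 'M[A]_(p + q, n) :=
  col_mx (map_mx (mmap iota (x 0)) (jac_mx F))
         (\matrix_(k, l) (a k l - iota e * x 0 l)).

(** The derivative of [polar_mx] at [x] in direction [v], with [a] held fixed. *)
Definition polar_der (A : comNzRingType) (iota : {rmorphism K -> A})
    (x v : 'rV[A]_n) : 'M[A]_(p + q, n) :=
  col_mx (\matrix_(k, l) point_der (mmap iota (x 0)) (v 0) (jac_mx F k l))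
         (\matrix_(k, l) (- (iota e * v 0 l))).

Section Functoriality.
Variables (A B : comNzRingType) (iota : {rmorphism K -> A}).
Variables (kappa : {rmorphism K -> B}) (phi : {rmorphism A -> B}).
Hypothesis phi_iota : forall c, phi (iota c) = kappa c.

Lemma map_mmap (x : 'rV[A]_n) f :
  phi (mmap iota (x 0) f) = mmap kappa (map_mx phi x 0) f.
Proof. by apply: rmorph_mmap => // i; rewrite mxE. Qed.

Lemma map_polar_mx x a :
  map_mx phi (polar_mx iota x a) = polar_mx kappa (map_mx phi x) (map_mx phi a).
Proof.
rewrite map_col_mx; congr col_mx; apply/matrixP => k l.
  by rewrite [LHS]mxE [in LHS]mxE map_mmap [RHS]mxE.
by rewrite !mxE rmorphB rmorphM phi_iota.
Qed.

Lemma map_polar_der x v :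
  map_mx phi (polar_der iota x v) = polar_der kappa (map_mx phi x) (map_mx phi v).
Proof.
rewrite map_col_mx; congr col_mx; apply/matrixP => k l; last first.
  by rewrite !mxE rmorphN rmorphM phi_iota.
rewrite [LHS]mxE [in LHS]mxE [RHS]mxE rmorph_sum; apply: eq_bigr => i _.
by rewrite rmorphM map_mmap [map_mx phi v 0 i]mxE.
Qed.

End Functoriality.

End PolarMatrix.

Section MatrixDerivation.
Variables (L : comNzRingType) (D : L -> L).
Hypotheses (DD : forall u v, D (u + v) = D u + D v).
Hypotheses (DM : forall u v, D (u * v) = u * D v + D u * v).

Lemma derivation0 : D 0 = 0.
Proof. by apply: (addrI (D 0)); rewrite -DD !addr0. Qed.

Lemma derivation_mulmx m k l (A : 'M[L]_(m, k)) (B : 'M[L]_(k, l)) :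
  map_mx D (A *m B) = A *m map_mx D B + map_mx D A *m B.
Proof.
apply/matrixP => i j; rewrite !mxE -big_split /=.
rewrite (big_morph D DD derivation0); apply: eq_bigr => t _.
by rewrite DM !mxE.
Qed.

End MatrixDerivation.

(* Differentiating [U *m M *m N = 0] along a derivation that moves the generic
   matrix [a] in direction [c] gives
   [U *m polar_der x v *m N = - rsubmx U *m c *m N], where [v] is the derivative
   of [x]; the right hand side is arbitrary. *)
Lemma generic_polar_der (K L : fieldType) (iota : {rmorphism K -> L})
  n p q m s t (F : 'I_p -> {mpoly K[n]}) (e : K) (sel : 'I_q -> 'I_m)
  (a : 'M[L]_(m, n)) (x : 'rV[L]_n) (J : 'M[L]_(n, p))
  (U : 'M[L]_(s, p + q)) (U' : 'M[L]_(p + q, s))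
  (N : 'M[L]_(n, t)) (N' : 'M[L]_(t, n)) (w : 'M[L]_(s, t)) :
  (forall k, k.+1%:R != 0 :> L) -> injective sel ->
  (forall P : {mpoly K[m * n]}, mmap iota (mxvec a 0) P = 0 -> P = 0) ->
  (forall k, mmap iota (x 0) (F k) = 0) ->
  map_mx (mmap iota (x 0)) (jac_mx F) *m J = 1%:M ->
  U *m U' = 1%:M -> U *m polar_mx F e iota x (rowsub sel a) = 0 ->
  N' *m N = 1%:M -> polar_mx F e iota x (rowsub sel a) *m N = 0 ->
  exists v : 'rV[L]_n, map_mx (mmap iota (x 0)) (jac_mx F) *m v^T = 0 /\
    U *m polar_der q F e iota x v *m N = w.
Proof.
move=> char0 sel_inj indep Fx GJ UU UM NN MN.
set M := polar_mx _ _ _ _ _ in UM MN.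
set jac := map_mx _ (jac_mx F) in GJ *.
pose U1 := lsubmx U; pose U2 := rsubmx U.
have UE : U = row_mx U1 U2 by rewrite hsubmxK.
(* As [U] kills [M] and the Jacobian has the right inverse [J], [U1] is determined by [U2]; so [U2]
   inherits a right inverse from [U]. *)
have [U2' U2K] : exists U2', U2 *m U2' = 1%:M.
  pose A := \matrix_(k, l) (rowsub sel a k l - iota e * x 0 l).
  have U1E : U1 = - U2 *m (A *m J).
    move: UM; rewrite UE mul_row_col => /(congr1 (mulmx^~ J)).
    rewrite mulmxDl mul0mx -!mulmxA GJ mulmx1 => /eqP.
    by rewrite addr_eq0 => /eqP ->; rewrite mulNmx.
  exists (row_mx (- (A *m J)) 1%:M *m U').
  by rewrite mulmxA mul_mx_row mulmx1 mulmxN -mulNmx -U1E -UE.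
(* Chosen so that - U2 c N = w; rows of [a] outside the image of [sel] are not moved. *)
pose c := - (U2' *m w *m N').
pose cfull : 'M[L]_(m, n) := \matrix_(k, l) \sum_j (sel j == k)%:R * c j l.
have cfullE : rowsub sel cfull = c.
  apply/matrixP => k l; rewrite [LHS]mxE [LHS]mxE (bigD1 k) //= eqxx mul1r.
  rewrite big1 ?addr0 // => j /negPf jk.
  by rewrite (inj_eq sel_inj) jk mul0r.
have [D [DD DM DC Da]] := derivation_exists char0 (mxvec cfull 0) indep.
have {}Da : map_mx D a = cfull.
  by apply/matrixP => k l; rewrite mxE -mxvecE Da mxvecE.
pose v := map_mx D x.
have Dev f : D (mmap iota (x 0) f) = point_der (mmap iota (x 0)) (v 0) f.
  rewrite (derivation_mmap _ DD DM DC); apply: eq_bigr => l _.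
  by rewrite /v mxE.
exists v; split.
  apply/matrixP => k j; rewrite (ord1 j) [RHS]mxE -(derivation0 DD) -(Fx k) Dev mxE.
  by apply: eq_bigr => l _; rewrite !mxE.
have DME : map_mx D M = polar_der q F e iota x v + col_mx 0 c.
  have DN u : D (- u) = - D u.
    by apply/eqP; rewrite -addr_eq0 -DD addNr derivation0.
  rewrite map_col_mx add_col_mx addr0; congr col_mx.
    by apply/matrixP => k l; rewrite [LHS]mxE [in LHS]mxE Dev [RHS]mxE.
  apply/matrixP => k l; rewrite -cfullE -Da.
  rewrite [LHS]mxE [in LHS]mxE DD DN DM DC mul0r addr0 [RHS]mxE addrC.
  by congr (_ + _); rewrite !mxE.
have : map_mx D (U *m M) *m N = 0.
  rewrite UM -[RHS](mul0mx _ N); congr (_ *m _).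
  by apply/matrixP => k l; rewrite !mxE derivation0.
rewrite (derivation_mulmx DD DM) mulmxDl -[_ *m M *m N]mulmxA MN mulmx0 addr0.
rewrite DME mulmxDr mulmxDl => /eqP; rewrite addr_eq0 => /eqP ->.
rewrite {1}UE mul_row_col mulmx0 add0r /c mulmxN mulNmx opprK.
by rewrite !mulmxA U2K mul1mx -mulmxA NN mulmx1.
Qed.

(** One-sided inverses [J], [U'], [N'] express the rank conditions by equations, which pass to the
    ultrapower. *)
Definition transversal_at (K : fieldType) n p q s t (F : 'I_p -> {mpoly K[n]})
    (e : K) (x : 'rV[K]_n) (a : 'M[K]_(q, n)) : Prop :=
  forall (J : 'M[K]_(n, p)) (U : 'M[K]_(s, p + q)) (U' : 'M[K]_(p + q, s))
    (N : 'M[K]_(n, t)) (N' : 'M[K]_(t, n)),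
  variety F x -> jacobian F x *m J = 1%:M ->
  U *m U' = 1%:M -> U *m polar_mx F e idfun x a = 0 ->
  N' *m N = 1%:M -> polar_mx F e idfun x a *m N = 0 ->
  forall w : 'M[K]_(s, t), exists v : 'rV[K]_n,
    jacobian F x *m v^T = 0 /\ U *m polar_der q F e idfun x v *m N = w.

Lemma generic_transversality (K : fieldType) n p q m s t
  (F : 'I_p -> {mpoly K[n]}) (e : K) (sel : 'I_q -> 'I_m) :
  (forall k, k.+1%:R != 0 :> K) -> injective sel ->
  exists2 D : {mpoly K[m * n]}, D != 0 & forall a : 'M[K]_(m, n),
    D.@[mxvec a 0] != 0 -> forall x, transversal_at s t F e x (rowsub sel a).
Proof.
move=> char0 sel_inj; apply: contrapT => noD.
pose T : pointedType := HB.pack_for pointedType 'M[K]_(m, n)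
  (isPointed.Build 'M[K]_(m, n) 0).
pose data := ('rV[K]_n * 'M[K]_(n, p) * ('M[K]_(s, p + q) * 'M[K]_(p + q, s)) *
  ('M[K]_(n, t) * 'M[K]_(t, n)) * 'M[K]_(s, t))%type.
pose bad_data (a : T) (z : data) :=
  let: (x, J, (U, U'), (N, N'), w) := z in
  [/\ variety F x, jacobian F x *m J = 1%:M,
      U *m U' = 1%:M /\ U *m polar_mx F e idfun x (rowsub sel a) = 0,
      N' *m N = 1%:M /\ polar_mx F e idfun x (rowsub sel a) *m N = 0 &
      forall v : 'rV[K]_n, ~ (jacobian F x *m v^T = 0 /\
        U *m polar_der q F e idfun x v *m N = w)].
pose bad a := exists z, bad_data a z.
have badP (D : {mpoly K[m * n]}) : D != 0 ->
    exists2 a : T, D.@[mxvec a 0] != 0 & bad a.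
  move=> D0; apply: contrapT => nb; apply: noD; exists D => // a Da x.
  move=> J U U' N N' Fx GJ UU UM NN MN w; apply: contrapT => nv; apply: nb.
  exists a => //; exists (x, J, (U, U'), (N, N'), w); split=> // v hv.
  by apply: nv; exists v.
have [z hz] : exists z : T -> data, forall a, bad a -> bad_data a (z a).
  have h a : exists za, bad a -> bad_data a za.
    have [[za ?]|nb] := pselect (bad a); first by exists za.
    by exists (0, 0, (0, 0), (0, 0), 0).
  by have [z hz] := choice h; exists z.
(* The trace on [bad] of the sets where a non-zero polynomial does not vanish; it is proper because
   [bad] is dense by [badP]. *)
pose Fil : set_system T := [set S | exists2 D : {mpoly K[m * n]}, D != 0 &
  forall a : T, D.@[mxvec a 0] != 0 -> bad a -> S a].
have FilP : ProperFilter Fil.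
  apply: Build_ProperFilter => [[D /badP [a Da ba] h]|]; first exact: (h a).
  split.
  - by exists 1; rewrite ?oner_neq0.
  - move=> S S' [D D0 h] [D' D'0 h']; exists (D * D'); first exact: mulf_neq0.
    move=> a; rewrite mevalM mulf_eq0 negb_or => /andP[Da D'a] ba.
    by split; [exact: h | exact: h'].
  - move=> S S' SS' [D D0 h]; exists D => // a Da ba.
    by apply: SS'; exact: h.
have [L [psi [psi0 psiN0 psi_surj psi_ex]]] := ultrapower K FilP.
pose iota : {rmorphism K -> L} := psi \o @cst_fun T K.
have char0L k : k.+1%:R != 0 :> L by rewrite -(rmorph_nat iota) fmorph_eq0.
have Fbad : Fil bad by exists 1; rewrite ?oner_neq0.
pose lift k l (f : T -> 'M[K]_(k, l)) : 'M[T -> K]_(k, l) :=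
  \matrix_(i, j) (fun a => f a i j).
have eval_lift k l (f : T -> 'M[K]_(k, l)) a : map_mx (@eval_at T K a) (lift k l f) = f a.
  by apply/matrixP => i j; rewrite !mxE.
have psi_mx k l (A B : 'M[T -> K]_(k, l)) :
    (forall a, bad a -> map_mx (@eval_at T K a) A = map_mx (@eval_at T K a) B) ->
    map_mx psi A = map_mx psi B.
  move=> h; apply/matrixP => i j; rewrite !mxE.
  apply/eqP; rewrite -subr_eq0 -rmorphB; apply/eqP/psi0.
  exists 1; rewrite ?oner_neq0 // => a _ /h /matrixP/(_ i j); rewrite !mxE => e'.
  by apply/eqP; rewrite -[X in X == _]/(A i j a - B i j a) subr_eq0; apply/eqP.
pose X := lift _ _ (fun a => (z a).1.1.1.1); pose J := lift _ _ (fun a => (z a).1.1.1.2).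
pose U := lift _ _ (fun a => (z a).1.1.2.1); pose U' := lift _ _ (fun a => (z a).1.1.2.2).
pose N := lift _ _ (fun a => (z a).1.2.1); pose N' := lift _ _ (fun a => (z a).1.2.2).
pose W := lift _ _ (fun a => (z a).2); pose Aid := lift m n (fun a : T => a).
pose cst0 : {rmorphism K -> (T -> K)} := @cst_fun T K.
pose jac0 := map_mx (mmap cst0 (X 0)) (jac_mx F).
pose M0 := polar_mx F e cst0 X (rowsub sel Aid).
have eval_jac a : map_mx (@eval_at T K a) jac0 = jacobian F (z a).1.1.1.1.
  rewrite -map_jac_mx -map_mx_comp; apply/matrixP => k l.
  rewrite [LHS]mxE [RHS]mxE -[LHS]/(eval_at a _).
  by rewrite (@map_mmap _ _ _ _ cst0 idfun) // eval_lift.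
have eval_M a : map_mx (@eval_at T K a) M0 =
    polar_mx F e idfun (z a).1.1.1.1 (rowsub sel a).
  by rewrite (@map_polar_mx _ _ _ _ _ _ _ _ cst0 idfun) // map_mxsub !eval_lift.
have psi_jac : map_mx psi jac0 = map_mx (mmap iota (map_mx psi X 0)) (jac_mx F).
  apply/matrixP => k l; rewrite [LHS]mxE [jac0 k l]mxE [RHS]mxE.
  by rewrite (@map_mmap _ _ _ _ cst0 iota).
have psi_M : map_mx psi M0 =
    polar_mx F e iota (map_mx psi X) (rowsub sel (map_mx psi Aid)).
  by rewrite (@map_polar_mx _ _ _ _ _ _ _ _ cst0 iota) // map_mxsub.
have hbad a : bad a -> [/\ variety F (z a).1.1.1.1,
      jacobian F (z a).1.1.1.1 *m (z a).1.1.1.2 = 1%:M,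
      (z a).1.1.2.1 *m (z a).1.1.2.2 = 1%:M /\ (z a).1.1.2.1 *m
        polar_mx F e idfun (z a).1.1.1.1 (rowsub sel a) = 0,
      (z a).1.2.2 *m (z a).1.2.1 = 1%:M /\
        polar_mx F e idfun (z a).1.1.1.1 (rowsub sel a) *m (z a).1.2.1 = 0 &
      forall v : 'rV[K]_n, ~ (jacobian F (z a).1.1.1.1 *m v^T = 0 /\
        (z a).1.1.2.1 *m polar_der q F e idfun (z a).1.1.1.1 v *m (z a).1.2.1 = (z a).2)].
  by move=> /hz; case: (z a) => -[[[x0 J0] [U0 U0']] [N0 N0']] w0.
(* The class of the tautological family a |-> a is a generic matrix: for a non-zero [P], the set
   where [P] does not vanish belongs to the filter. *)
have indep (P : {mpoly K[m * n]}) :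
    mmap iota (mxvec (map_mx psi Aid) 0) P = 0 -> P = 0.
  move=> P0; apply/eqP/negP => /negP PN0.
  have : psi (fun a : T => P.@[mxvec a 0]) != 0.
    by apply: psiN0; exists P.
  suff -> : psi (fun a : T => P.@[mxvec a 0]) =
      mmap iota (mxvec (map_mx psi Aid) 0) P by rewrite P0 eqxx.
  rewrite -map_mxvec -(@map_mmap _ _ _ _ cst0 iota) //; congr (psi _).
  apply/funext => a; rewrite -[RHS]/(eval_at a _) (@map_mmap _ _ _ _ cst0 idfun) //.
  by rewrite map_mxvec eval_lift.
have [|||||| v [Jv Uv]] := @generic_polar_der K L iota n p q m s t F e sel
  (map_mx psi Aid) (map_mx psi X) (map_mx psi J) (map_mx psi U) (map_mx psi U')
  (map_mx psi N) (map_mx psi N') (map_mx psi W) char0L sel_inj indep.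
- move=> k; rewrite -(@map_mmap _ _ _ _ cst0 iota) //; apply: psi0.
  exists 1; rewrite ?oner_neq0 // => a _ /hbad [Fx _ _ _ _] /=.
  rewrite -[LHS]/(eval_at a _) (@map_mmap _ _ _ _ cst0 idfun) //.
  by rewrite eval_lift; exact: Fx.
- rewrite -psi_jac -map_mxM -(map_mx1 psi); apply: psi_mx => a /hbad [_ GJ _ _ _].
  by rewrite map_mxM eval_jac eval_lift map_mx1.
- rewrite -map_mxM -(map_mx1 psi); apply: psi_mx => a /hbad [_ _ [UU _] _ _].
  by rewrite map_mxM !eval_lift map_mx1.
- rewrite -psi_M -map_mxM -(map_mx0 psi); apply: psi_mx => a /hbad [_ _ [_ UM] _ _].
  by rewrite map_mxM eval_M eval_lift map_mx0.
- rewrite -map_mxM -(map_mx1 psi); apply: psi_mx => a /hbad [_ _ _ [NN _] _].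
  by rewrite map_mxM !eval_lift map_mx1.
- rewrite -psi_M -map_mxM -(map_mx0 psi); apply: psi_mx => a /hbad [_ _ _ [_ MN] _].
  by rewrite map_mxM eval_M eval_lift map_mx0.
have [v0 hv0] := choice (fun l => psi_surj (v 0 l)).
pose V0 : 'rV[T -> K]_n := \row_l v0 l.
have psiV : map_mx psi V0 = v by apply/rowP => l; rewrite !mxE hv0.
pose der0 := polar_der q F e cst0 X V0.
(* The entries of both equations satisfied by [v], as finitely many functions of the matrix. They
   vanish together at some bad matrix, where the value of [V0] contradicts badness. *)
pose res (i : 'I_p + 'I_s * 'I_t) : T -> K :=
  match i with
  | inl k => (jac0 *m V0^T) k 0
  | inr ij => (U *m der0 *m N - W) ij.1 ij.2
  end.
have [||a ba ha] := psi_ex _ res bad; [| exact: Fbad |].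
  move=> [k|[i j]] /=.
    have : map_mx psi (jac0 *m V0^T) = 0 by rewrite map_mxM -map_trmx psi_jac psiV.
    by move=> /matrixP/(_ k 0); rewrite [LHS]mxE [RHS]mxE.
  have : map_mx psi (U *m der0 *m N - W) = 0.
    rewrite map_mxB !map_mxM (@map_polar_der _ _ _ _ _ _ _ _ cst0 iota) //.
    by rewrite psiV Uv subrr.
  by move=> /matrixP/(_ i j); rewrite [LHS]mxE [RHS]mxE.
have [_ _ _ _ nv] := hbad _ ba.
apply: (nv (map_mx (@eval_at T K a) V0)); split.
  rewrite map_trmx -eval_jac -map_mxM; apply/matrixP => k j.
  by rewrite (ord1 j) [LHS]mxE [RHS]mxE; exact: (ha (inl k)).
apply/eqP; rewrite -subr_eq0 -(eval_lift _ _ (fun a => (z a).1.1.2.1)).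
rewrite -(eval_lift _ _ (fun a => (z a).1.2.1)) -(eval_lift _ _ (fun a => (z a).2)).
rewrite -(eval_lift _ _ (fun a => (z a).1.1.1.1)).
rewrite -(@map_polar_der _ _ _ _ _ _ _ _ cst0 idfun) // -!map_mxM -map_mxB.
apply/eqP/matrixP => i j.
by rewrite [LHS]mxE [RHS]mxE; exact: (ha (inr (i, j))).
Qed.

(** * Rank conditions and Schur complements *)

Lemma minors_vanishP (K : fieldType) m n k (M : 'M[K]_(m, n)) :
  minors_vanish k M <-> (\rank M < k)%N.
Proof.
split=> [hM|rM r c]; last first.
  apply/eqP/negP => /negP det0.
  have /mxrank_unit : mxsub r c M \in unitmx by rewrite unitmxE unitfE.
  rewrite -[M]mulmx1 -[M]mul1mx -mulmxA mxsub_mul => rk.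
  have := leq_trans (mxrankM_maxr (rowsub r 1%:M) (colsub c (M *m 1%:M))).
  move=> /(_ (\rank M)); rewrite rk -mulmx_colsub => /(_ (mxrankM_maxl _ _)).
  by rewrite leqNgt rM.
rewrite ltnNge; apply/negP => kM.
pose w := widen_ord kM; pose f := maxrankfun M \o w.
have w_inj : injective w by move=> i j /(congr1 val) /= /val_inj.
have /row_freeP [X XE] := maxrowsub_free M.
have Yfree : row_free (rowsub f M).
  apply/row_freeP; exists (colsub w X).
  have -> : rowsub f M = rowsub w (rowsub (maxrankfun M) M).
    by apply/matrixP => i j; rewrite !mxE.
  rewrite -mxsub_mul XE; apply/matrixP => i j.
  by rewrite !mxE (inj_eq w_inj).
have Yfull : row_full (rowsub f M)^T by rewrite /row_full mxrank_tr.
have := fullrowsub_unit Yfull; rewrite unitmxE unitfE => /eqP; apply.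
rewrite -(hM f (fullrankfun Yfull)) -[RHS]det_tr; congr (\det _).
by apply/matrixP => i j; rewrite !mxE.
Qed.

Lemma exists_kernel (K : fieldType) m n k (M : 'M[K]_(m, n)) :
  (k + \rank M <= m)%N ->
  exists (U : 'M[K]_(k, m)) (U' : 'M[K]_(m, k)), U *m M = 0 /\ U *m U' = 1%:M.
Proof.
move=> h; have [|U /row_freeP [U' UU] /sub_kermxP UM] :=
  @exists_row_basis K m m k (kermx M); first by rewrite mxrank_ker; lia.
by exists U, U'.
Qed.

Lemma exists_cokernel (K : fieldType) m n k (M : 'M[K]_(m, n)) :
  (k + \rank M <= n)%N ->
  exists (N : 'M[K]_(n, k)) (N' : 'M[K]_(k, n)), M *m N = 0 /\ N' *m N = 1%:M.
Proof.
rewrite -mxrank_tr => /exists_kernel [U [U' [UM UU]]].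
exists U^T, U'^T; split; last by rewrite -trmx_mul UU trmx1.
by rewrite -[M]trmxK -trmx_mul UM trmx0.
Qed.

(* Bases adapted to [M]: in the coordinates given by [P; U] on the left and
   [Q, N] on the right, [M] becomes the identity matrix of size [\rank M]
   bordered by zeros. *)
Lemma exists_rank_normal_form (K : fieldType) m n s t r (M : 'M[K]_(m, n)) :
  \rank M = r -> (m = s + r)%N -> (n = t + r)%N ->
  exists P Q U k N N' R S,
    [/\ P *m M *m Q = 1%:M :> 'M_r, U *m M = 0 :> 'M_(s, n),
        M *m N = 0 :> 'M_(m, t) & [/\ U *m k = 1%:M, P *m k = 0,
        N' *m N = 1%:M & Q *m R + N *m S = 1%:M]].
Proof.
move=> <- ms nt.
have /row_freeP [Q RQ] := row_base_free M.
have /row_fullP [P PC] := col_base_full M.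
have [|U [k0 [UM Uk]]] := @exists_kernel K m n s M; first by rewrite -ms.
have [|N [N' [MN NN]]] := @exists_cokernel K m n t M; first by rewrite -nt.
have UC : U *m col_base M = 0.
  by rewrite -[LHS]mulmx1 -RQ mulmxA -[X in X *m _]mulmxA mulmx_base UM mul0mx.
have RN : row_base M *m N = 0.
  by rewrite -[LHS]mul1mx -PC -mulmxA [X in _ *m X]mulmxA mulmx_base MN mulmx0.
(* The subtracted term makes [P] kill the column and leaves its product with [U] unchanged, since
   [U] kills the column space of [M]. *)
exists P, Q, U, (k0 - col_base M *m (P *m k0)), N, N'.
have [S SE] : exists S, 1%:M - Q *m row_base M = N *m S.
  have sub : ((1%:M - Q *m row_base M)^T <= N^T)%MS.
    have sub1 : (N^T <= kermx M^T)%MS.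
      by apply/sub_kermxP; rewrite -trmx_mul MN trmx0.
    have rkN : \rank N^T = t.
      apply/eqP; rewrite eqn_leq rank_leq_row /=.
      rewrite -[X in (X <= _)%N](mxrank1 K) -trmx1 -NN trmx_mul.
      exact: mxrankM_maxl.
    have sub2 : (kermx M^T <= N^T)%MS.
      rewrite -(geq_leqif (mxrank_leqif_sup sub1)) rkN mxrank_ker mxrank_tr.
      by rewrite leq_subLR addnC -nt.
    apply: submx_trans sub2; apply/sub_kermxP; rewrite -trmx_mul -{1}(mulmx_base M).
    by rewrite -mulmxA mulmxBr mulmx1 mulmxA RQ mul1mx subrr mulmx0 trmx0.
  have [X XE] := submxP sub; exists X^T.
  by rewrite -[LHS]trmxK XE trmx_mul trmxK.
exists (row_base M), S; split=> //.
- have PM : P *m M = row_base M by rewrite -[X in P *m X]mulmx_base mulmxA PC mul1mx.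
  by rewrite PM RQ.
- split=> //.
  + by rewrite mulmxBr Uk [X in _ - X]mulmxA UC mul0mx subr0.
  + by rewrite mulmxBr [X in _ - X]mulmxA PC mul1mx subrr.
  + by rewrite -SE addrC subrK.
Qed.

Section PolarDer.
Variables (K : fieldType) (n p q : nat) (F : 'I_p -> {mpoly K[n]}) (e : K).

Lemma polar_der_sum (x v : 'rV[K]_n) :
  polar_der q F e idfun x v =
    \sum_l v 0 l *: polar_der q F e idfun x (delta_mx 0 l).
Proof.
apply/matrixP => k l; rewrite summxE.
under eq_bigr => j _ do rewrite mxE.
rewrite -[k]splitK; case: fintype.split => k' /=.
  under eq_bigr => j _ do rewrite col_mxEu mxE.
  rewrite col_mxEu mxE /point_der; apply: eq_bigr => j _.
  rewrite (bigD1 j) //= big1 ?addr0 => [|j' jj']; last first.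
    by rewrite [delta_mx _ _ _ _]mxE (negPf jj') andbF mulr0.
  by rewrite [delta_mx _ _ _ _]mxE !eqxx mulr1 mulrC.
under eq_bigr => j _ do rewrite col_mxEd !mxE.
rewrite col_mxEd mxE (bigD1 l) //= big1 ?addr0 => [|j jl]; last first.
  by rewrite (eq_sym l) (negPf jl) mulr0 oppr0 mulr0.
by rewrite eqxx mulr1 mulrN mulrC.
Qed.

(** A linear map from the kernel of the Jacobian, of dimension n - p, onto a space of dimension s
    t. *)
Lemma polar_der_onto_dim s t (x : 'rV[K]_n) (U : 'M[K]_(s, p + q))
  (N : 'M[K]_(n, t)) (J : 'M[K]_(n, p)) :
  jacobian F x *m J = 1%:M ->
  (forall w, exists v : 'rV[K]_n, jacobian F x *m v^T = 0 /\
    U *m polar_der q F e idfun x v *m N = w) ->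
  (s * t + p <= n)%N.
Proof.
move=> GJ onto.
pose A : 'M[K]_(n, s * t) := \matrix_(l, c)
  mxvec (U *m polar_der q F e idfun x (delta_mx 0 l) *m N) 0 c.
have AE v : mxvec (U *m polar_der q F e idfun x v *m N) = v *m A.
  rewrite polar_der_sum mulmx_sumr mulmx_suml linear_sum /=.
  apply/rowP => c; rewrite summxE [RHS]mxE; apply: eq_bigr => l _.
  by rewrite -scalemxAr -scalemxAl linearZ mxE [A l c]mxE.
have onto' (c : 'I_(s * t)) : exists v : 'rV[K]_n,
    jacobian F x *m v^T = 0 /\ v *m A = delta_mx 0 c.
  have [v [Jv vw]] := onto (vec_mx (delta_mx 0 c)).
  by exists v; split=> //; rewrite -AE vw vec_mxK.
have [f hf] := choice onto'.
pose V := \matrix_c f c.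
have VA : V *m A = 1%:M.
  by apply/row_matrixP => c; rewrite row_mul rowK row1 (proj2 (hf c)).
have VJ : V *m (jacobian F x)^T = 0.
  apply/row_matrixP => c; rewrite row_mul rowK row0.
  by rewrite -[LHS]trmxK trmx_mul trmxK (proj1 (hf c)) trmx0.
have := mulmx0_rank_max VJ; rewrite mxrank_tr.
have /eqP -> : row_free V by apply/row_freeP; exists A.
by have /eqP -> : row_free (jacobian F x) by apply/row_freeP; exists J.
Qed.

End PolarDer.

Section SchurComplement.
Variables (K : fieldType) (m n r t : nat) (M : 'M[K]_(m, n)).
Variables (P : 'M[K]_(r, m)) (Q : 'M[K]_(n, r)) (U : 'rV[K]_m) (N : 'M[K]_(n, t)).

Let A := P *m M *m Q.
Let u := \det A *: U - U *m M *m Q *m \adj A *m P.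

(** [\det A] times the Schur complement U M N - U M Q A^-1 P M N; the adjugate keeps it polynomial
    in [M]. It equals u M N, where the row [u] satisfies u M Q = 0. *)
Definition schur_row : 'rV[K]_t :=
  \det A *: (U *m M *m N) - U *m M *m Q *m (\adj A *m (P *m M *m N)).

Let uMQ : u *m M *m Q = 0.
Proof.
rewrite !mulmxBl -!scalemxAl -(mulmxA _ P M) -(mulmxA _ (P *m M) Q) -/A.
by rewrite -(mulmxA _ (\adj A)) mul_adj_mx mul_mx_scalar subrr.
Qed.

Let uMN : u *m M *m N = schur_row.
Proof. by rewrite !mulmxBl -!scalemxAl /schur_row !mulmxA. Qed.

(** Since M Q already has rank r, the row space of [M] meets the kernel of [Q] trivially; so u M Q =
    0 gives u M = 0. *)
Lemma schur_row_eq0 : \det A != 0 -> (\rank M <= r)%N -> schur_row = 0.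
Proof.
move=> detA rM; have rA : \rank A = r by rewrite mxrank_unit // unitmxE unitfE.
have : (M :&: kermx Q)%MS = 0.
  apply/eqP; rewrite -mxrank_eq0; have := mxrank_mul_ker M Q.
  have : (r <= \rank (M *m Q))%N.
    by rewrite -{1}rA /A -mulmxA; exact: mxrankM_maxr.
  by move: rM; lia.
move=> cap0; have : (u *m M <= M :&: kermx Q)%MS.
  by rewrite sub_capmx submxMl; apply/sub_kermxP.
by rewrite cap0 submx0 -uMN => /eqP ->; rewrite mul0mx.
Qed.

(** Here u M Q and u M N both vanish, so [u] lies in the left kernel of [M]; it is non-zero because
    [u *m k] is [\det A]. *)
Lemma schur_row_rank (k : 'cV[K]_m) (R : 'M[K]_(r, n)) (S : 'M[K]_(t, n)) :
  \det A != 0 -> schur_row = 0 -> U *m k = 1%:M -> P *m k = 0 ->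
  Q *m R + N *m S = 1%:M -> (\rank M < m)%N.
Proof.
move=> detA S0 Uk Pk QR.
have uM : u *m M = 0.
  by rewrite -[LHS]mulmx1 -QR mulmxDr !mulmxA uMQ uMN S0 !mul0mx addr0.
have uk : u *m k = (\det A)%:M.
  by rewrite mulmxBl -scalemxAl Uk -(mulmxA _ P k) Pk mulmx0 subr0 scalemx1.
rewrite ltn_neqAle rank_leq_row andbT; apply/negP => Mfree.
have /eqP := uM; rewrite mulmx_free_eq0 // => /eqP u0.
move: uk; rewrite u0 mul0mx => /matrixP/(_ 0 0); rewrite !mxE eqxx => /esym/eqP.
by rewrite (negPf detA).
Qed.

End SchurComplement.

Section PointDerivationMatrix.
Variables (C S : comNzRingType) (n : nat).
Variables (ev : {rmorphism {mpoly C[n]} -> S}) (v : 'I_n -> S).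

Lemma point_der0 : point_der ev v 0 = 0.
Proof. by rewrite -mpolyC0 point_derC. Qed.

Lemma point_der_mulmx m k l (A : 'M_(m, k)) (B : 'M_(k, l)) :
  map_mx (point_der ev v) (A *m B) =
    map_mx ev A *m map_mx (point_der ev v) B +
    map_mx (point_der ev v) A *m map_mx ev B.
Proof.
apply/matrixP => i j; rewrite !mxE -big_split /=.
rewrite (big_morph _ (point_derD ev v) point_der0); apply: eq_bigr => h _.
by rewrite point_derM !mxE.
Qed.

Lemma point_der_cst m k (A : 'M[C]_(m, k)) :
  map_mx (point_der ev v) (map_mx (@mpolyC n C) A) = 0.
Proof. by apply/matrixP => i j; rewrite !mxE point_derC. Qed.

End PointDerivationMatrix.

Section SchurDerivative.
Variables (K : fieldType) (m n n' r t : nat) (M : 'M[{mpoly K[n]}]_(m, n')).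
Variables (P : 'M[K]_(r, m)) (Q : 'M[K]_(n', r)) (U : 'rV[K]_m) (N : 'M[K]_(n', t)).

Local Notation cst := (map_mx (@mpolyC n K)).
Local Notation at_ y := (map_mx (meval y)).

Definition schur_det : {mpoly K[n]} := \det (cst P *m M *m cst Q).

(* Numerator of the Schur complement, multiplied once more by [schur_det] so
   that it vanishes wherever the rank of [M] is at most [r]. *)
Definition schur_eqs (j : 'I_t) : {mpoly K[n]} := schur_det *
  (schur_det *: (cst U *m M *m cst N) - cst U *m M *m cst Q *m
    (\adj (cst P *m M *m cst Q) *m (cst P *m M *m cst N))) 0 j.

Lemma map_cst y k l (X : 'M[K]_(k, l)) : at_ y (cst X) = X.
Proof. by apply/matrixP => i j; rewrite !mxE mevalC. Qed.

Lemma schur_detE y : schur_det.@[y] = \det (P *m at_ y M *m Q).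
Proof. by rewrite -[LHS]/(meval y _) -det_map_mx !map_mxM !map_cst. Qed.

Lemma schur_eqsE y j : (schur_eqs j).@[y] =
  \det (P *m at_ y M *m Q) * schur_row (at_ y M) P Q U N 0 j.
Proof.
rewrite mevalM schur_detE /schur_row; congr (_ * _).
have -> : forall Z : 'rV_t, (Z 0 j).@[y] = at_ y Z 0 j by move=> Z; rewrite mxE.
rewrite map_mxB map_mxZ !map_mxM map_mx_adj !map_mxM !map_cst.
by rewrite /= schur_detE.
Qed.

Variables (x v : 'I_n -> K).
Hypotheses (PMQ : P *m at_ x M *m Q = 1%:M) (UM : U *m at_ x M = 0).
Hypothesis MN : at_ x M *m N = 0.

Let der := point_der (meval x) v.

(** At [x] both factors of the subtracted product vanish, so it contributes nothing to first order,
    and [schur_det] takes the value 1. *)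
Lemma schur_eqs_der j :
  der (schur_eqs j) = (U *m map_mx der M *m N) 0 j.
Proof.
have det1x : schur_det.@[x] = 1 by rewrite schur_detE PMQ det1.
have UMN : map_mx (meval x) (cst U *m M *m cst N) = 0.
  by rewrite !map_mxM !map_cst UM mul0mx.
set W := cst U *m M *m cst N in UMN.
pose CC := cst U *m M *m cst Q.
pose Y := \adj (cst P *m M *m cst Q) *m (cst P *m M *m cst N).
have CCx : at_ x CC = 0 by rewrite !map_mxM !map_cst UM mul0mx.
have Yx : at_ x Y = 0.
  by rewrite !map_mxM !map_cst -(mulmxA P) MN !mulmx0.
have derW : map_mx der W = U *m map_mx der M *m N.
  rewrite !point_der_mulmx !point_der_cst !mul0mx mulmx0 add0r addr0 /=.
  by rewrite !map_cst.
pose Z := schur_det *: W - CC *m Y.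
have Zx : (Z 0 j).@[x] = 0.
  have : at_ x Z = 0 by rewrite map_mxB map_mxZ UMN map_mxM CCx mul0mx scaler0 subr0.
  by move=> /matrixP/(_ 0 j); rewrite mxE [RHS]mxE.
transitivity (schur_det.@[x] * der (Z 0 j) + der schur_det * (Z 0 j).@[x]).
  exact: point_derM.
rewrite Zx det1x mul1r mulr0 addr0 -derW [RHS]mxE /Z mxE [X in _ + X]mxE [X in X + _]mxE.
rewrite [der _]point_derB.
transitivity (schur_det.@[x] * der (W 0 j) + der schur_det * (W 0 j).@[x]
    - map_mx der (CC *m Y) 0 j).
  by congr (_ - _); [exact: point_derM | rewrite [RHS]mxE].
have -> : (W 0 j).@[x] = 0.
  by move: UMN => /matrixP/(_ 0 j); rewrite mxE [RHS]mxE.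
rewrite point_der_mulmx [map_mx (meval x) CC]CCx [map_mx (meval x) Y]Yx.
rewrite mul0mx mulmx0 addr0 [X in _ - X]mxE subr0.
by rewrite det1x mul1r mulr0 addr0.
Qed.

End SchurDerivative.

(** * Polar varieties *)

Definition polar_locus (K : fieldType) n p q (i : nat) (F : 'I_p -> {mpoly K[n]})
    (e : K) (a : 'M[K]_(q, n)) : set 'rV[K]_n :=
  [set y | regular_points F y /\
     minors_vanish (n - i).+1 (polar_mx F e idfun y a)].

Section PolarSmooth.
Variables (K : closedFieldType) (n p q i : nat) (F : 'I_p -> {mpoly K[n]}) (e : K).
Variable a : 'M[K]_(q, n).
Hypotheses (char0 : forall k, k.+1%:R != 0 :> K).
Hypotheses (pq : (p + q = (n - i).+1)%N) (i_le : (i <= n)%N).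
Hypothesis dim_lt : (n < p + (2 * i + 2))%N.

Local Notation locus := (polar_locus i F e a).

Let MP : 'M[{mpoly K[n]}]_(p + q, n) :=
  polar_mx F e (@mpolyC n K) (\row_l 'X_l) (map_mx (@mpolyC n K) a).

Let MPE (y : 'rV[K]_n) : map_mx (meval (y 0)) MP = polar_mx F e idfun y a.
Proof.
rewrite (@map_polar_mx _ _ _ _ _ _ _ _ (@mpolyC n K) idfun) => [|c]; last exact: mevalC.
congr polar_mx; apply/matrixP => k l; last by rewrite !mxE; exact: mevalC.
by rewrite (ord1 k) !mxE; exact: mevalXU.
Qed.

Let MP_der (x v : 'rV[K]_n) :
  map_mx (point_der (meval (x 0)) (v 0)) MP = polar_der q F e idfun x v.
Proof.
rewrite map_col_mx; congr col_mx; apply/matrixP => k l.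
  rewrite [LHS]mxE [in LHS]mxE [RHS]mxE; congr point_der.
  rewrite -[RHS]mmap_mpolyC_id.
  by apply: rmorph_mmap (idfun : {rmorphism _ -> _}) _ _ _ _ _ => // j; rewrite mxE.
rewrite [LHS]mxE [in LHS]mxE [RHS]mxE mxE [X in _ * X]mxE.
by rewrite point_derB point_derM !point_derC point_derX mul0r addr0 sub0r /= mevalC.
Qed.

(** The equations [F] and the minors are polynomial in the point, so they persist on the closure. *)
Lemma polar_locus_closed_regular x : zariski_closure locus x ->
  \rank (jacobian F x) = p -> locus x.
Proof.
move=> Wx rJ; split.
  by split=> // k; apply: Wx => y [[Fy _] _]; exact: Fy.
move=> r c; rewrite -MPE -map_mxsub det_map_mx; apply: Wx => y [_ minors].
by rewrite -[LHS]/(meval _ _) -det_map_mx map_mxsub MPE.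
Qed.

Lemma polar_smooth_at x : transversal_at 1 i F e x a ->
  transversal_at 2 i.+1 F e x a -> zariski_closure locus x ->
  \rank (jacobian F x) = p -> smooth_at (zariski_closure locus) x.
Proof.
move=> tr1 tr2 Wx rJ; have Bx := polar_locus_closed_regular Wx rJ.
have [[Fx _] /minors_vanishP rM] := Bx.
set M := polar_mx _ _ _ _ _ in rM.
have /row_freeP [J GJ] : row_free (jacobian F x) by apply/eqP.
(* A smaller rank gives a left kernel of dimension 2 and a right kernel of dimension i + 1;
   transversality then yields 2(i + 1) + p <= n, against [dim_lt]. *)
have rank_M : \rank M = (n - i)%N.
  apply/eqP; rewrite eqn_leq -ltnS rM /= leqNgt; apply/negP => rM'.
  have [|U [U' [UM UU]]] := @exists_kernel K _ _ 2 M; first lia.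
  have [|N [N' [MN NN]]] := @exists_cokernel K _ _ i.+1 M; first lia.
  have := polar_der_onto_dim GJ (tr2 _ _ _ _ _ Fx GJ UU UM NN MN).
  move: dim_lt; lia.
have [||P [Q [U [k [N [N' [R [S [PMQ UM MN [Uk Pk NN QR]]]]]]]]]] :=
  @exists_rank_normal_form K _ _ 1 i _ M rank_M; [lia | lia |].
pose G2 := schur_eqs MP P Q U N.
(* Where [h] is non-zero, the block P M Q is invertible and the Jacobian of [F] has rank [p]. *)
pose h := schur_det MP P Q * \det (jac_mx F *m map_mx (@mpolyC n K) J).
have onto := tr1 _ _ _ _ _ Fx GJ Uk UM NN MN.
apply: (@smooth_at_local_eq K n (p + i) locus x (cat_fun F G2) h) => //.
- move=> j y [[Fy _] /minors_vanishP ry]; rewrite /cat_fun.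
  case: fintype.split => {}j; first exact: Fy.
  rewrite schur_eqsE MPE.
  have [->|detA] := eqVneq (\det (P *m polar_mx F e idfun y a *m Q)) 0.
    by rewrite mul0r.
  by rewrite schur_row_eq0 // mxE mulr0.
- rewrite mevalM schur_detE MPE PMQ det1 mul1r -[X in X != 0]/(meval _ _).
  by rewrite -det_map_mx map_mxM map_jac_mx map_cst GJ det1 oner_neq0.
- move=> y Gy; rewrite mevalM mulf_eq0 negb_or schur_detE MPE => /andP[detA detJ].
  have Fy : variety F y.
    move=> j; have := Gy (lshift i j); rewrite /cat_fun.
    by rewrite -[lshift i j]/(unsplit (inl j)) unsplitK.
  have S0 : schur_row (polar_mx F e idfun y a) P Q U N = 0.
    apply/rowP => j; have := Gy (rshift p j); rewrite /cat_fun.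
    rewrite -[rshift p j]/(unsplit (inr j)) unsplitK schur_eqsE MPE => /eqP.
    by rewrite mulf_eq0 (negPf detA) => /eqP ->; rewrite mxE.
  split; last first.
    by apply/minors_vanishP; rewrite -pq; exact: schur_row_rank detA S0 Uk Pk QR.
  split=> //; apply/eqP; rewrite eqn_leq rank_leq_row /=.
  move: detJ; rewrite -[X in X != 0]/(meval _ _) -det_map_mx map_mxM map_jac_mx map_cst.
  rewrite -unitfE -unitmxE => /mxrank_unit {1}<-; exact: mxrankM_maxl.
- apply: row_freeI => u; rewrite jacobian_cat -[u]hsubmxK mul_row_col => eu.
  (* Transversality provides a [v] in the kernel of the Jacobian of [F] on which the differentials
     of [G2] form the j-th unit vector; pairing the relation with [v] isolates the j-th
     coefficient. *)
  have u2 : rsubmx u = 0.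
    apply/rowP => j; have [v [Jv Uv]] := onto (delta_mx 0 j).
    have Gv : jacobian G2 x *m v^T = (delta_mx 0 j)^T.
      apply/matrixP => j' c; rewrite (ord1 c) [RHS]mxE -Uv -MP_der.
      have PMQ' : P *m map_mx (meval (x 0)) MP *m Q = 1%:M by rewrite MPE.
      have UM' : U *m map_mx (meval (x 0)) MP = 0 by rewrite MPE.
      have MN' : map_mx (meval (x 0)) MP *m N = 0 by rewrite MPE.
      rewrite -(schur_eqs_der (v 0) PMQ' UM' MN') mxE; apply: eq_bigr => l _.
      by rewrite !mxE.
    move: eu => /(congr1 (mulmx^~ v^T)).
    rewrite mulmxDl -!mulmxA Jv Gv mulmx0 add0r mul0mx.
    move=> /matrixP/(_ 0 0); rewrite trmx_delta -colE !mxE.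
    by move=> <-.
  move: eu; rewrite u2 mul0mx addr0 => /(congr1 (mulmx^~ J)).
  by rewrite -mulmxA GJ mulmx1 mul0mx => ->; rewrite row_mx0.
Qed.

End PolarSmooth.

(** * Generic matrices and conclusion *)

Lemma mpoly_nonroot (K : closedFieldType) N (D : {mpoly K[N]}) :
  D != 0 -> exists y : 'rV[K]_N, D.@[y 0] != 0.
Proof.
(* Nullstellensatz at the generic point of affine space, whose coordinates are the variables
   themselves. *)
move=> D0; pose tof : {rmorphism {mpoly K[N]} -> {fraction {mpoly K[N]}}} :=
  @FracField.tofrac {mpoly K[N]}.
have := tofrac_eq0 D; rewrite (negPf D0) -[FracField.tofrac D]/(tof D) rmorph_mpolyE.
move=> /negbT /nullstellensatz_point [y [_ Dy]]; exists (\row_i y i).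
by rewrite (meval_eq (v2 := y)) // => j; rewrite mxE.
Qed.

(** [D] is the minor on the first [m] columns, which equals 1 at [pid_mx m]. *)
Lemma full_rank_polynomial (K : fieldType) m n : (m <= n)%N ->
  exists2 D : {mpoly K[m * n]}, D != 0 &
    forall a : 'M[K]_(m, n), D.@[mxvec a 0] != 0 -> \rank a = m.
Proof.
move=> mn; pose X : 'M[{mpoly K[m * n]}]_(m, n) := vec_mx (\row_j 'X_j).
pose g := widen_ord mn; pose D := \det (mxsub id g X).
have DE a : D.@[mxvec a 0] = \det (mxsub id g a).
  rewrite -[LHS]/(meval _ _) -det_map_mx map_mxsub; congr (\det (mxsub _ _ _)).
  apply: (can_inj mxvecK); rewrite map_vec_mx vec_mxK; apply/rowP => j.
  by rewrite !mxE; exact: mevalXU.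
exists D.
  apply/eqP => D0; have := DE (pid_mx m); rewrite D0 meval0.
  have -> : mxsub id g (pid_mx m : 'M[K]_(m, n)) = 1%:M.
    by apply/matrixP => k j; rewrite !mxE /= ltn_ord andbT.
  by rewrite det1 => /esym/eqP; rewrite oner_eq0.
move=> a; rewrite DE => da; apply/eqP; rewrite eqn_leq rank_leq_row /=.
rewrite leqNgt; apply/negP => /minors_vanishP minors.
by move/eqP: da; apply; exact: minors.
Qed.

(** Transversality for kernel dimensions (2, i + 1) excludes a rank drop of two; for (1, i) it makes
    the local equations independent. *)
Lemma generic_polar_smooth (K : closedFieldType) n p q m i
  (F : 'I_p -> {mpoly K[n]}) (e : K) (sel : 'I_q -> 'I_m) :
  (forall k, k.+1%:R != 0 :> K) -> injective sel ->
  (p + q = (n - i).+1)%N -> (i <= n)%N -> (n < p + (2 * i + 2))%N ->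
  exists2 D : {mpoly K[m * n]}, D != 0 & forall a : 'M[K]_(m, n),
    D.@[mxvec a 0] != 0 ->
    forall x, zariski_closure (polar_locus i F e (rowsub sel a)) x ->
      \rank (jacobian F x) = p ->
      smooth_at (zariski_closure (polar_locus i F e (rowsub sel a))) x.
Proof.
move=> char0 sel_inj pq i_le dim_lt.
have [D1 D10 tr1] := generic_transversality 1 i F e char0 sel_inj.
have [D2 D20 tr2] := generic_transversality 2 i.+1 F e char0 sel_inj.
exists (D1 * D2); first exact: mulf_neq0.
move=> a; rewrite mevalM mulf_eq0 negb_or => /andP[D1a D2a] x.
by apply: polar_smooth_at => //; [exact: tr1 | exact: tr2].
Qed.

Lemma polar_mx_classic (K : fieldType) n p q (F : 'I_p -> {mpoly K[n]})
  (a : 'M[K]_(q, n)) x : polar_mx F 0 idfun x a = col_mx (jacobian F x) a.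
Proof.
rewrite -map_jac_mx; congr col_mx; apply/matrixP => k l.
by rewrite !mxE mul0r subr0.
Qed.

Lemma polar_mx_dual (K : fieldType) n p q (F : 'I_p -> {mpoly K[n]})
  (a : 'M[K]_(q, n)) x : polar_mx F 1 idfun x a =
  col_mx (jacobian F x) (\matrix_(k, l) (a k l - x 0 l)).
Proof.
rewrite -map_jac_mx; congr col_mx; apply/matrixP => k l.
by rewrite !mxE mul1r.
Qed.

Lemma classic_polarE (K : fieldType) n p (F : 'I_p -> {mpoly K[n]})
  (a : 'M[K]_(n - p, n)) i :
  classic_polar F a i = zariski_closure (polar_locus i F 0 (polar_rows a i)).
Proof.
congr zariski_closure; apply/seteqP.
by split=> x []; rewrite /polar_locus /= polar_mx_classic.
Qed.

Lemma dual_polarE (K : fieldType) n p (F : 'I_p -> {mpoly K[n]})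
  (a : 'M[K]_(n - p, n)) i :
  dual_polar F a i = zariski_closure (polar_locus i F 1 (polar_rows a i)).
Proof.
congr zariski_closure; apply/seteqP.
by split=> x []; rewrite /polar_locus /= polar_mx_dual.
Qed.

Theorem proposition9 (R : realType) (n p : nat) (hp : (1 <= p)%N)
  (hpn : (p < n)%N) (F : 'I_p -> {mpoly rat[n]})
  (hF : reduced_regular_sequence F)
  (hI : forall f : {mpoly rat[n]},
     ideal_first F p f <->
     vanishing_ideal (variety (complexify R F)) (map_mpoly ratr f))
  (i : nat) (hi1 : (1 <= i)%N) (hi2 : (i <= n - p)%N)
  (hi3 : (2 * i + 2 > n - p)%N) :
  exists U : set 'M[R[i]]_(n - p, n),
    [/\ zariski_open_mx U, U !=set0,
        forall a, U a -> \rank a = (n - p)%N &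
        forall a, U a ->
          (forall x, classic_polar (complexify R F) a i x ->
             \rank (jacobian (complexify R F) x) = p ->
             smooth_at (classic_polar (complexify R F) a i) x) /\
          (forall x, dual_polar (complexify R F) a i x ->
             \rank (jacobian (complexify R F) x) = p ->
             smooth_at (dual_polar (complexify R F) a i) x)].
Proof.
set G := complexify R F.
have char0 k : k.+1%:R != 0 :> R[i] by rewrite Num.Theory.pnatr_eq0.
pose sel := widen_ord (geq_minr (n - p - i).+1 (n - p)).
have sel_inj : injective sel by move=> j k /(congr1 val) /= /val_inj.
(* As i >= 1, the minimum is its first argument. *)
have pq : (p + minn (n - p - i).+1 (n - p) = (n - i).+1)%N by lia.
have i_le : (i <= n)%N by lia.
have dim_lt : (n < p + (2 * i + 2))%N by lia.
have [D0 D00 smooth0] := generic_polar_smooth G 0 char0 sel_inj pq i_le dim_lt.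
have [D1 D10 smooth1] := generic_polar_smooth G 1 char0 sel_inj pq i_le dim_lt.
have [D2 D20 rank2] := full_rank_polynomial R[i] (leq_subr p n).
(* The factors take care of the classic case, the dual case and the full rank of [a]. *)
pose D := D0 * D1 * D2.
have D_neq0 : D != 0 by rewrite !mulf_neq0.
pose U : set 'M[R[i]]_(n - p, n) := [set a | D.@[mxvec a 0] != 0].
have UP a : U a -> [/\ D0.@[mxvec a 0] != 0, D1.@[mxvec a 0] != 0 &
    D2.@[mxvec a 0] != 0].
  by rewrite /U /= !mevalM !mulf_eq0 !negb_or => /andP[/andP[]].
exists U; split.
- exists (zeros [set D]); first by exists [set D].
  apply/seteqP; rewrite zeros1P; split=> a /=; first by move/eqP.
  by move=> h; apply/eqP.
- have [y Dy] := mpoly_nonroot D_neq0; exists (vec_mx y).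
  by rewrite /U /= vec_mxK.
- by move=> a /UP [_ _ /rank2].
- move=> a /UP [D0a D1a _]; rewrite classic_polarE dual_polarE.
  by split; [exact: smooth0 | exact: smooth1].
Qed.
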